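(* Let $\Omega\subset\mathbb{R}^n$ be a bounded open set with smooth boundary, $\mu>0$, $2\mu+n\lambda\ge0$, $\kappa>0$, $\gamma>1$, $R>0$, $\rho_0\in C(\bar\Omega)$ with $\rho_0>0$ in $\Omega$, $\rho_0=0$ on $\partial\Omega$, and $u_0,e_0$ continuous with $e_0\ge0$, $e_0\not\equiv0$ in $\Omega$. Then for every $T>0$ the problem (summation over repeated indices) $$\rho_0\partial_tv^i+(\gamma-1)b_i^j\partial_j(J^{-1}\rho_0\mathfrak e)=\mu b_l^k\partial_k(J^{-1}b_l^j\partial_jv^i)+(\mu+\lambda)b_i^k\partial_k(J^{-1}b_l^j\partial_jv^l),$$ $$\rho_0\partial_t\mathfrak e+(\gamma-1)J^{-1}\rho_0\mathfrak e\, b_i^j\partial_jv^i=\tfrac{\mu}{2}J^{-1}|b_l^j\partial_jv^i+(b_l^j\partial_jv^i)^*|^2+\lambda J^{-1}(b_i^j\partial_jv^i)^2+\tfrac{\kappa(\gamma-1)}{R}b_l^k\partial_k(J^{-1}b_l^j\partial_j\mathfrak e)$$ in $\Omega\times(0,T]$, together with $\eta_t=v$, $(v,\mathfrak e,\eta)=(u_0,e_0,x)$ on $\Omega\times\{t=0\}$, and $\mathfrak e=\partial_{x_i}\mathfrak e=0$ on $\partial\Omega\times(0,T]$, has no solution $(v,\mathfrak e,\eta)$ in $C^{2,1}(\bar\Omega\times[0,T])$.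
   Context: Here $\eta:\Omega\times[0,T]\to\mathbb{R}^n$ is the flow map, $J=\det D\eta$, $B=(D\eta)^{-1}$ with entries $B_i^j$, and $b=JB$ (transpose of the cofactor matrix of $D\eta$) with entries $b_i^j$; $(\cdot)^*$ denotes the transposed matrix; $|\cdot|$ of a matrix is the Frobenius norm. $C^{2,1}$ means $C^2$ in $x$ and $C^1$ in $t$. *)

(* Defs.v *)
From Stdlib Require Import Reals Lra List.
Open Scope R_scope.

(** Points of R^n are represented as [nat -> R]; a point lies in R^n when
    all coordinates of index >= n vanish. Indices i,j,k,l range over 0..n-1. *)
Definition vec := nat -> R.

Fixpoint sumR (n : nat) (f : nat -> R) : R :=
  match n with O => 0 | S m => sumR m f + f m end.

Definition inRn (n : nat) (x : vec) : Prop := forall k, (n <= k)%nat -> x k = 0.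

Definition vdist (n : nat) (x y : vec) : R :=
  sqrt (sumR n (fun k => (x k - y k) ^ 2)).

Definition shift (x : vec) (j : nat) (s : R) : vec :=
  fun k => if Nat.eqb k j then x k + s else x k.

Definition is_open_set (n : nat) (O : vec -> Prop) : Prop :=
  forall x, O x -> exists r, 0 < r /\
    forall y, inRn n y -> vdist n x y < r -> O y.

Definition is_bounded_set (n : nat) (O : vec -> Prop) : Prop :=
  exists M, forall x, O x -> vdist n x (fun _ => 0) <= M.

Definition closure (n : nat) (O : vec -> Prop) (x : vec) : Prop :=
  inRn n x /\ forall r, 0 < r -> exists y, O y /\ vdist n x y < r.

Definition boundary (n : nat) (O : vec -> Prop) (x : vec) : Prop :=
  closure n O x /\ ~ O x.

Definition cont_on (n : nat) (S : vec -> Prop) (f : vec -> R) : Prop :=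
  forall x, S x -> forall eps, 0 < eps -> exists del, 0 < del /\
    forall y, S y -> vdist n x y < del -> Rabs (f y - f x) < eps.

Definition cont_xt (n : nat) (Om : vec -> Prop) (T : R) (f : vec -> R -> R) : Prop :=
  forall x t, closure n Om x -> 0 <= t <= T ->
  forall eps, 0 < eps -> exists del, 0 < del /\
    forall y s, closure n Om y -> 0 <= s <= T ->
      vdist n x y < del -> Rabs (s - t) < del -> Rabs (f y s - f x t) < eps.

Definition pd (F : vec -> R) (x : vec) (j : nat) (L : R) : Prop :=
  derivable_pt_lim (fun s => F (shift x j s)) 0 L.

(** g : R^n -> R is C^infinity: all iterated partial derivatives exist
    everywhere and are continuous. D l is the iterated derivative along the
    list of directions l (innermost derivative last in the list). *)
Definition smooth_fun (n : nat) (g : vec -> R) : Prop :=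
  exists D : list nat -> vec -> R,
    D nil = g /\
    (forall l j x, inRn n x -> (j < n)%nat -> pd (D l) x j (D (j :: l) x)) /\
    (forall l, cont_on n (inRn n) (D l)).

(** Smooth boundary (Evans' definition): near every boundary point, after
    choosing a coordinate axis k and an orientation sg, Om is the region
    below the graph of a smooth function g of the other coordinates. *)
Definition smooth_boundary (n : nat) (Om : vec -> Prop) : Prop :=
  forall p, boundary n Om p ->
  exists (r : R) (k : nat) (sg : R) (g : vec -> R),
    0 < r /\ (k < n)%nat /\ (sg = 1 \/ sg = -1) /\ smooth_fun n g /\
    (forall x s, g (shift x k s) = g x) /\
    (forall x, inRn n x -> vdist n p x < r -> (Om x <-> sg * x k < g x)).

Definition C21 (n : nat) (Om : vec -> Prop) (T : R) (f ft : vec -> R -> R)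
  (fx : nat -> vec -> R -> R) (fxx : nat -> nat -> vec -> R -> R) : Prop :=
  (forall x t j, Om x -> 0 <= t <= T -> (j < n)%nat ->
     pd (fun y => f y t) x j (fx j x t)) /\
  (forall x t j k, Om x -> 0 <= t <= T -> (j < n)%nat -> (k < n)%nat ->
     pd (fun y => fx j y t) x k (fxx j k x t)) /\
  (forall x t, Om x -> 0 < t < T -> derivable_pt_lim (fun s => f x s) t (ft x t)) /\
  cont_xt n Om T f /\ cont_xt n Om T ft /\
  (forall j, (j < n)%nat -> cont_xt n Om T (fx j)) /\
  (forall j k, (j < n)%nat -> (k < n)%nat -> cont_xt n Om T (fxx j k)).

Definition skip (i r : nat) : nat := if Nat.ltb r i then r else S r.
Definition minor (i j : nat) (A : nat -> nat -> R) : nat -> nat -> R :=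
  fun r c => A (skip i r) (skip j c).
Fixpoint detR (n : nat) (A : nat -> nat -> R) : R :=
  match n with
  | O => 1
  | S m => sumR (S m) (fun j => (-1) ^ j * A O j * detR m (minor O j A))
  end.
Definition cofactor (n : nat) (A : nat -> nat -> R) (i j : nat) : R :=
  (-1) ^ (i + j) * detR (n - 1) (minor i j A).

(** The Jacobian matrix D eta (row i, column j: d_j eta^i), J = det D eta,
    and b_i^j = (cofactor matrix of D eta)_{ij}, so that b = J B with
    B = (D eta)^{-1}, B_i^j = ((D eta)^{-1})_{ji}, and b_i^j d_j = J d_{y_i}. *)
Definition Jac (n : nat) (etax : nat -> nat -> vec -> R -> R) (x : vec) (t : R) : R :=
  detR n (fun i j => etax i j x t).
Definition bmat (n : nat) (etax : nat -> nat -> vec -> R -> R) (i j : nat)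
  (x : vec) (t : R) : R :=
  cofactor n (fun i' j' => etax i' j' x t) i j.

(* Main.v *)
(* A direct barrier argument, with no strong maximum principle. For small time
   J is close to 1 and b to the identity, so the energy equation becomes
     rho (e_t + c e) >= sum_l D^2 e (b_l, b_l) + beta . grad e,   rho > 0,
   with bounded coefficients and uniform ellipticity: the viscous dissipation is
   nonnegative because 2 mu + n lam >= 0. Comparison gives e >= 0, since rho > 0
   inside Om makes the zeroth order term strict. Let e0 (x0) > 0 and let y0 be the
   point of the complement of Om nearest to x0. On a family of balls around x0
   that expand from a small one at t = 0 and touch y0 at a later time t1,
     eps (exp (- a |x - x0|^2) - exp (- a r(t)^2)),   r(t)^2 affine in t,
   is a subsolution for large a, hence lies below e. So e (., t1) grows linearly
   away from y0 along the segment to x0, against e = grad e = 0 at y0. *)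
From Stdlib Require Import Reals Lra Lia Psatz FunctionalExtensionality Classical ClassicalEpsilon.
From Coquelicot Require Import Coquelicot.
Require Import Defs.
Open Scope R_scope.

(** * Finite sums *)

(** The density vanishes at the boundary, so dividing by it would leave unbounded coefficients. It
    is therefore kept as a weight on the time derivative: the barrier uses only an upper bound for
    [rho], and comparison only its sign at one interior point. The second order part stays a sum of
    second derivatives in the directions [b_l], so contact of two functions is settled by the
    one-variable second derivative test along lines. Comparison asks for the two differential
    inequalities only where e lies below the barrier. This confines the Gaussian to the shell rr <=
    |x - x0|^2 < rr + m t: outside the expanding ball it is nonpositive while e >= 0, and near x0
    continuity keeps e above it. On the shell the ellipticity term of the Gaussian is of order a^2,
    whereas the speed of expansion, the drift and the zeroth order term cost at most order a. Hence
    the ball may expand as fast as needed to reach y0 while e is still positive near x0. *)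

Lemma sumR_ext n f g : (forall i, (i < n)%nat -> f i = g i) -> sumR n f = sumR n g.
Proof.
  induction n as [|n IH]; simpl; intros H; [easy|].
  rewrite IH by (intros; apply H; lia). now rewrite H by lia.
Qed.

Lemma sumR_plus n f g : sumR n (fun i => f i + g i) = sumR n f + sumR n g.
Proof. induction n as [|n IH]; simpl; [lra|rewrite IH; ring]. Qed.

Lemma sumR_scal n c f : sumR n (fun i => c * f i) = c * sumR n f.
Proof. induction n as [|n IH]; simpl; [ring|rewrite IH; ring]. Qed.

Lemma sumR_minus n f g : sumR n (fun i => f i - g i) = sumR n f - sumR n g.
Proof. induction n as [|n IH]; simpl; [ring|rewrite IH; ring]. Qed.

Lemma sumR_const n c : sumR n (fun _ => c) = INR n * c.
Proof. induction n as [|n IH]; [simpl; ring|rewrite S_INR; simpl; rewrite IH; ring]. Qed.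

Lemma sumR_le n f g : (forall i, (i < n)%nat -> f i <= g i) -> sumR n f <= sumR n g.
Proof.
  induction n as [|n IH]; simpl; intros H; [lra|].
  apply Rplus_le_compat; [apply IH; intros; apply H; lia|apply H; lia].
Qed.

Lemma sumR_nonneg n f : (forall i, (i < n)%nat -> 0 <= f i) -> 0 <= sumR n f.
Proof.
  intros H. replace 0 with (sumR n (fun _ => 0)) by (rewrite sumR_const; ring).
  now apply sumR_le.
Qed.

Lemma sumR_eq0 n f : (forall i, (i < n)%nat -> f i = 0) -> sumR n f = 0.
Proof. intros H. rewrite (sumR_ext n f (fun _ => 0)) by easy. rewrite sumR_const; ring. Qed.

Lemma sumR_term_le n f i :
  (forall j, (j < n)%nat -> 0 <= f j) -> (i < n)%nat -> f i <= sumR n f.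
Proof.
  induction n as [|n IH]; simpl; intros H Hi; [lia|].
  assert (0 <= sumR n f) by (apply sumR_nonneg; intros; apply H; lia).
  assert (0 <= f n) by (apply H; lia).
  destruct (Nat.eq_dec i n) as [->|Hne]; [lra|].
  assert (f i <= sumR n f) by (apply IH; [intros; apply H; lia|lia]). lra.
Qed.

Lemma sumR_swap n m (f : nat -> nat -> R) :
  sumR n (fun i => sumR m (f i)) = sumR m (fun j => sumR n (fun i => f i j)).
Proof.
  induction n as [|n IH]; simpl; [now rewrite sumR_eq0|].
  now rewrite IH, <- sumR_plus.
Qed.

Lemma sumR_delta n i f : (i < n)%nat ->
  sumR n (fun j => (if Nat.eqb j i then 1 else 0) * f j) = f i.
Proof.
  induction n as [|n IH]; intros Hi; [lia|]. simpl.
  destruct (Nat.eq_dec i n) as [->|Hne].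
  - rewrite Nat.eqb_refl, sumR_eq0; [ring|].
    intros j Hj. destruct (Nat.eqb_spec j n); [lia|ring].
  - rewrite IH by lia. destruct (Nat.eqb_spec n i); [lia|ring].
Qed.

(** Cauchy-Schwarz as nonnegativity of the variance: the squared deviations from the mean S0 / N add
    up to Q - S0^2 / N. *)
Lemma sumR_sqr_le n f : (sumR n f) ^ 2 <= INR n * sumR n (fun i => f i ^ 2).
Proof.
  destruct n as [|n]; [simpl; lra|].
  set (N := S n). set (S0 := sumR N f). set (Q := sumR N (fun i => f i ^ 2)).
  assert (HN : 0 < INR N) by (apply lt_0_INR; unfold N; lia).
  assert (H : 0 <= sumR N (fun i => (f i - S0 / INR N) ^ 2))
    by (apply sumR_nonneg; intros; apply pow2_ge_0).
  rewrite (sumR_ext N _ (fun i => f i ^ 2 + ((- 2 * (S0 / INR N)) * f i + (S0 / INR N) ^ 2))) in H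
    by (intros; ring).
  rewrite sumR_plus, sumR_plus, sumR_scal, sumR_const in H. fold S0 Q in H.
  replace (Q + (-2 * (S0 / INR N) * S0 + INR N * (S0 / INR N) ^ 2))
    with (Q - S0 ^ 2 / INR N) in H by (field; lra).
  assert (S0 ^ 2 = INR N * (S0 ^ 2 / INR N)) by (field; lra). nra.
Qed.

(** * Compactness of the space-time cylinder *)

(** The divisor n + 1 is positive even for n = 0 and makes the resulting Euclidean bound strict. *)
Lemma vdist_lt n x y r : 0 < r ->
  (forall i, (i < n)%nat -> Rabs (x i - y i) < r / (INR n + 1)) -> vdist n x y < r.
Proof.
  intros Hr H. unfold vdist. set (q := r / (INR n + 1)) in *.
  assert (Hn := pos_INR n).
  assert (Hq : 0 < q) by (apply Rdiv_lt_0_compat; lra).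
  assert (Hrq : r = (INR n + 1) * q) by (unfold q; field; lra).
  rewrite <- (sqrt_pow2 r) by lra. apply sqrt_lt_1_alt. split.
  - apply sumR_nonneg; intros; apply pow2_ge_0.
  - apply Rle_lt_trans with (sumR n (fun _ => q ^ 2)).
    + apply sumR_le. intros i Hi. rewrite <- pow2_abs.
      apply pow_incr. split; [apply Rabs_pos|left; auto].
    + rewrite sumR_const, Hrq. nra.
Qed.

Lemma coord_le_vdist n x y i : (i < n)%nat -> Rabs (x i - y i) <= vdist n x y.
Proof.
  intros Hi. unfold vdist. rewrite <- sqrt_Rsqr_abs. apply sqrt_le_1_alt.
  rewrite Rsqr_pow2.
  apply (sumR_term_le n (fun k => (x k - y k) ^ 2)); [|easy].
  intros; apply pow2_ge_0.
Qed.

Lemma vdist_refl n x : vdist n x x = 0.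
Proof. unfold vdist. rewrite sumR_eq0; [apply sqrt_0|intros; ring]. Qed.

Lemma closure_incl n (Om : vec -> Prop) x :
  (forall y, Om y -> inRn n y) -> Om x -> closure n Om x.
Proof. intros H Hx. split; [auto|]. intros r Hr. exists x. now rewrite vdist_refl. Qed.

(** The selection need not increase: [k <= phi k] is all that a tail argument uses, and it survives
    composition. Beyond each k it picks a term within 1 / (k + 1) of an accumulation point. *)
Lemma bounded_real_subseq (u : nat -> R) M : (forall k, Rabs (u k) <= M) ->
  exists (phi : nat -> nat) (l : R), (forall k, (k <= phi k)%nat) /\
    Un_cv (fun k => u (phi k)) l.
Proof.
  intros H.
  destruct (Bolzano_Weierstrass u (fun c => - M <= c <= M) (compact_P3 _ _)) as [l Hl].
  { intros k. specialize (H k). now apply Rabs_le_between. }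
  assert (Hk : forall k, exists p, (k <= p)%nat /\ Rabs (u p - l) < / (INR k + 1)).
  { intros k. assert (0 < / (INR k + 1)) as Hp
      by (apply Rinv_0_lt_compat; pose proof (pos_INR k); lra).
    apply (Hl (fun z => Rabs (z - l) < / (INR k + 1)) k).
    exists (mkposreal _ Hp). now intros z Hz. }
  exists (fun k => proj1_sig (constructive_indefinite_description _ (Hk k))), l.
  split.
  - intros k. now destruct constructive_indefinite_description as [p [Hp ?]].
  - intros eps Heps. destruct (archimed_cor1 eps Heps) as [N [HN HN0]].
    exists N. intros k HkN. destruct constructive_indefinite_description as [p [Hp Hlt]]; simpl.
    unfold Rdist. apply Rlt_trans with (1 := Hlt). apply Rle_lt_trans with (2 := HN).
    apply Rinv_le_contravar; [now apply lt_0_INR|].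
    apply le_INR in HkN. lra.
Qed.

Lemma Un_cv_reindex u l (phi : nat -> nat) :
  (forall k, (k <= phi k)%nat) -> Un_cv u l -> Un_cv (fun k => u (phi k)) l.
Proof.
  intros Hphi Hu eps Heps. destruct (Hu eps Heps) as [N HN]. exists N.
  intros k Hk. apply HN. specialize (Hphi k). lia.
Qed.

Lemma bounded_vec_subseq n (u : nat -> vec) M :
  (forall k i, (i < n)%nat -> Rabs (u k i) <= M) ->
  exists (phi : nat -> nat) (l : vec), (forall k, (k <= phi k)%nat) /\ inRn n l /\
    forall i, (i < n)%nat -> Un_cv (fun k => u (phi k) i) (l i).
Proof.
  induction n as [|n IH]; intros H.
  - exists (fun k => k), (fun _ => 0). repeat split; intros; lia || easy.
  - destruct IH as (phi & l & Hphi & Hl & Hc); [intros; apply H; lia|].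
    destruct (bounded_real_subseq (fun k => u (phi k) n) M) as (psi & l' & Hpsi & Hc').
    { intros; apply H; lia. }
    exists (fun k => phi (psi k)), (fun i => if Nat.eqb i n then l' else l i).
    split; [|split].
    + intros k. specialize (Hpsi k). specialize (Hphi (psi k)). lia.
    + intros k Hk. destruct (Nat.eqb_spec k n); [lia|]. apply Hl; lia.
    + intros i Hi. destruct (Nat.eqb_spec i n) as [->|Hne]; [easy|].
      apply (Un_cv_reindex (fun k => u (phi k) i)); [easy|]. apply Hc; lia.
Qed.

Lemma Un_cv_coords_vdist n (u : nat -> vec) (l : vec) :
  (forall i, (i < n)%nat -> Un_cv (fun k => u k i) (l i)) ->
  forall eps, 0 < eps -> exists N, forall k, (N <= k)%nat -> vdist n l (u k) < eps.
Proof.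
  intros H eps Heps.
  assert (He : 0 < eps / (INR n + 1))
    by (apply Rdiv_lt_0_compat; pose proof (pos_INR n); lra).
  assert (HN : exists N, forall k, (N <= k)%nat -> forall i, (i < n)%nat ->
    Rabs (l i - u k i) < eps / (INR n + 1)).
  { revert He. generalize (eps / (INR n + 1)) as q. intros q Hq. clear eps Heps.
    induction n as [|n IH]; [exists O; intros; lia|].
    destruct IH as [N1 HN1]; [intros; apply H; lia|].
    destruct (H n ltac:(lia) q Hq) as [N2 HN2].
    exists (N1 + N2)%nat. intros k Hk i Hi.
    destruct (Nat.eq_dec i n) as [->|Hne]; [|apply HN1; lia].
    rewrite Rabs_minus_sym. apply HN2. lia. }
  destruct HN as [N HN]. exists N. intros k Hk. apply vdist_lt; auto.
Qed.

Lemma bounded_coord n O x M : (forall x, O x -> vdist n x (fun _ => 0) <= M) ->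
  closure n O x -> forall i, (i < n)%nat -> Rabs (x i) <= M + 1.
Proof.
  intros HM [_ Hx] i Hi. destruct (Hx 1 Rlt_0_1) as [y [Hy Hd]].
  specialize (HM y Hy).
  assert (H1 := coord_le_vdist n x y i Hi).
  assert (H2 := coord_le_vdist n y (fun _ => 0) i Hi). simpl in H2.
  replace (x i) with ((x i - y i) + (y i - 0)) by ring.
  eapply Rle_trans; [apply Rabs_triang|lra].
Qed.

Lemma closure_closed n O x : inRn n x ->
  (forall r, 0 < r -> exists y, closure n O y /\ vdist n x y < r) -> closure n O x.
Proof.
  intros Hx H. split; [easy|]. intros r Hr.
  assert (Hq : 0 < r / (INR n + 1) / 2).
  { apply Rdiv_lt_0_compat; [apply Rdiv_lt_0_compat|]; pose proof (pos_INR n); lra. }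
  destruct (H _ Hq) as [y [[_ Hy] Hd]]. destruct (Hy _ Hq) as [z [Hz Hd']].
  exists z. split; [easy|]. apply vdist_lt; [easy|]. intros i Hi.
  assert (H1 := coord_le_vdist n x y i Hi). assert (H2 := coord_le_vdist n y z i Hi).
  replace (x i - z i) with ((x i - y i) + (y i - z i)) by ring.
  eapply Rle_lt_trans; [apply Rabs_triang|lra].
Qed.

(** Sequential compactness of the closed cylinder, phrased through arbitrarily late indices so that
    the arguments by contradiction below need no explicit subsequence. *)
Lemma spacetime_cluster n Om T (u : nat -> vec) (t : nat -> R) :
  is_bounded_set n Om -> (forall k, closure n Om (u k)) -> (forall k, 0 <= t k <= T) ->
  exists x s, closure n Om x /\ 0 <= s <= T /\ forall del N, 0 < del ->
    exists k, (N <= k)%nat /\ vdist n x (u k) < del /\ Rabs (t k - s) < del.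
Proof.
  intros [M HM] Hu Ht.
  destruct (bounded_vec_subseq n u (M + 1)) as (phi & x & Hphi & Hx & Hc).
  { intros k i Hi. eapply bounded_coord; eauto. }
  destruct (bounded_real_subseq (fun k => t (phi k)) T) as (psi & s & Hpsi & Hs).
  { intros k. specialize (Ht (phi k)). apply Rabs_le_between. lra. }
  assert (Hcl : forall del N, 0 < del ->
    exists k, (N <= k)%nat /\ vdist n x (u k) < del /\ Rabs (t k - s) < del).
  { intros del N Hdel.
    destruct (Un_cv_coords_vdist n (fun k => u (phi (psi k))) x) with (eps := del) as [N1 HN1];
      [|easy|].
    { intros i Hi. apply (Un_cv_reindex (fun k => u (phi k) i)); auto. }
    destruct (Hs del Hdel) as [N2 HN2].
    set (k := (N + N1 + N2)%nat). exists (phi (psi k)). repeat split.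
    - specialize (Hpsi k). specialize (Hphi (psi k)). unfold k in *. lia.
    - apply HN1. unfold k; lia.
    - apply HN2. unfold k; lia. }
  exists x, s. split; [|split; [|easy]].
  - apply closure_closed; [easy|]. intros r Hr. destruct (Hcl r O Hr) as (k & _ & Hk & _).
    now exists (u k).
  - split; apply Rnot_lt_le; intros Hlt.
    + destruct (Hcl (- s) O) as (k & _ & _ & Hk); [lra|]. specialize (Ht k).
      apply Rabs_def2 in Hk. lra.
    + destruct (Hcl (s - T) O) as (k & _ & _ & Hk); [lra|]. specialize (Ht k).
      apply Rabs_def2 in Hk. lra.
Qed.

Lemma cont_xt_bounded n Om T f : is_bounded_set n Om -> cont_xt n Om T f ->
  exists M, forall x t, closure n Om x -> 0 <= t <= T -> Rabs (f x t) <= M.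
Proof.
  intros Hb Hf. apply NNPP. intros Hno.
  assert (H : forall k : nat, exists p : vec * R,
    closure n Om (fst p) /\ 0 <= snd p <= T /\ INR k < Rabs (f (fst p) (snd p))).
  { intros k. apply NNPP. intros Hk. apply Hno. exists (INR k). intros x t Hx Ht.
    apply Rnot_lt_le. intros Hlt. apply Hk. now exists (x, t). }
  set (p := fun k => proj1_sig (constructive_indefinite_description _ (H k))).
  assert (Hp : forall k, closure n Om (fst (p k)) /\ 0 <= snd (p k) <= T /\
    INR k < Rabs (f (fst (p k)) (snd (p k)))).
  { intros k. unfold p. now destruct constructive_indefinite_description. }
  destruct (spacetime_cluster n Om T (fun k => fst (p k)) (fun k => snd (p k)) Hb)
    as (x & s & Hx & Hs & Hc); [apply Hp|apply Hp|].
  destruct (Hf x s Hx Hs 1 Rlt_0_1) as [del [Hdel Hd]].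
  destruct (INR_unbounded (Rabs (f x s) + 1)) as [N HN].
  destruct (Hc del N Hdel) as (k & HkN & H1 & H2).
  destruct (Hp k) as (Hk1 & Hk2 & Hk3).
  specialize (Hd _ _ Hk1 Hk2 H1 H2). apply le_INR in HkN.
  assert (Htr := Rabs_triang_inv (f (fst (p k)) (snd (p k))) (f x s)). lra.
Qed.

(** Offending points with times at most 1 / (k + 1) cluster at some (x, 0), where continuity
    compares both f (x_k, t_k) and f (x_k, 0) with the same value f (x, 0). *)
Lemma cont_xt_unif_initial n Om T f : is_bounded_set n Om -> 0 < T -> cont_xt n Om T f ->
  forall eps, 0 < eps -> exists tau, 0 < tau /\
    forall x t, closure n Om x -> 0 <= t <= T -> t <= tau -> Rabs (f x t - f x 0) < eps.
Proof.
  intros Hb HT Hf eps Heps. apply NNPP. intros Hno.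
  assert (H : forall k : nat, exists p : vec * R,
    closure n Om (fst p) /\ 0 <= snd p <= T /\ snd p <= / (INR k + 1) /\
    eps <= Rabs (f (fst p) (snd p) - f (fst p) 0)).
  { intros k. apply NNPP. intros Hk. apply Hno. exists (/ (INR k + 1)).
    split; [apply Rinv_0_lt_compat; pose proof (pos_INR k); lra|].
    intros x t Hx Ht Ht'.
    apply Rnot_le_lt. intros Hlt. apply Hk. now exists (x, t). }
  set (p := fun k => proj1_sig (constructive_indefinite_description _ (H k))).
  assert (Hp : forall k, closure n Om (fst (p k)) /\ 0 <= snd (p k) <= T /\
    snd (p k) <= / (INR k + 1) /\ eps <= Rabs (f (fst (p k)) (snd (p k)) - f (fst (p k)) 0)).
  { intros k. unfold p. now destruct constructive_indefinite_description. }
  destruct (spacetime_cluster n Om T (fun k => fst (p k)) (fun k => snd (p k)) Hb)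
    as (x & s & Hx & Hs & Hc); [apply Hp|apply Hp|].
  destruct (Hf x 0 Hx ltac:(lra) (eps / 2) ltac:(lra)) as [del [Hdel Hd]].
  destruct (archimed_cor1 del Hdel) as [N [HN HN0]].
  destruct (Hc del N Hdel) as (k & HkN & H1 & _).
  destruct (Hp k) as (Hk1 & Hk2 & Hk3 & Hk4).
  assert (Hsmall : snd (p k) < del).
  { apply Rle_lt_trans with (1 := Hk3). apply Rle_lt_trans with (2 := HN).
    apply Rinv_le_contravar; [now apply lt_0_INR|]. apply le_INR in HkN. lra. }
  assert (Ha := Hd _ (snd (p k)) Hk1 Hk2 H1 ltac:(rewrite Rminus_0_r, Rabs_pos_eq; lra)).
  assert (Hb0 := Hd _ 0 Hk1 ltac:(lra) H1 ltac:(rewrite Rminus_0_r, Rabs_R0; lra)).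
  revert Hk4. apply Rlt_not_le.
  replace (f (fst (p k)) (snd (p k)) - f (fst (p k)) 0) with
    ((f (fst (p k)) (snd (p k)) - f x 0) - (f (fst (p k)) 0 - f x 0)) by ring.
  eapply Rle_lt_trans; [apply Rabs_triang|]. rewrite Rabs_Ropp. lra.
Qed.

Lemma cont_xt_attains_min n Om T f : is_bounded_set n Om -> 0 <= T ->
  (exists x, closure n Om x) -> cont_xt n Om T f ->
  exists x t, closure n Om x /\ 0 <= t <= T /\
    forall y s, closure n Om y -> 0 <= s <= T -> f x t <= f y s.
Proof.
  intros Hb HT [x0 Hx0] Hf.
  destruct (cont_xt_bounded n Om T f Hb Hf) as [M HM].
  (* The infimum of f is obtained as - m, with m the supremum of - f. *)
  destruct (completeness (fun v => exists x t, closure n Om x /\ 0 <= t <= T /\ v = - f x t))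
    as [m [Hub Hlub]].
  { exists M. intros v (x & t & Hx & Ht & ->). specialize (HM x t Hx Ht).
    apply Rabs_le_between in HM. lra. }
  { exists (- f x0 0), x0, 0. split; [easy|split; [lra|easy]]. }
  assert (H : forall k : nat, exists p : vec * R,
    closure n Om (fst p) /\ 0 <= snd p <= T /\ f (fst p) (snd p) < - m + / (INR k + 1)).
  { intros k. apply NNPP. intros Hk.
    assert (Hpos : 0 < / (INR k + 1)) by (apply Rinv_0_lt_compat; pose proof (pos_INR k); lra).
    assert (m <= m - / (INR k + 1)); [|lra].
    apply Hlub. intros v (x & t & Hx & Ht & ->). apply Rnot_lt_le. intros Hlt.
    apply Hk. exists (x, t); simpl. split; [easy|split; [easy|lra]]. }
  set (p := fun k => proj1_sig (constructive_indefinite_description _ (H k))).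
  assert (Hp : forall k, closure n Om (fst (p k)) /\ 0 <= snd (p k) <= T /\
    f (fst (p k)) (snd (p k)) < - m + / (INR k + 1)).
  { intros k. unfold p. now destruct constructive_indefinite_description. }
  destruct (spacetime_cluster n Om T (fun k => fst (p k)) (fun k => snd (p k)) Hb)
    as (x & s & Hx & Hs & Hc); [apply Hp|apply Hp|].
  exists x, s. split; [easy|]. split; [easy|]. intros y t Hy Ht.
  assert (- f y t <= m) by (apply Hub; exists y, t; auto).
  apply Rle_trans with (- m); [|lra]. apply Rnot_lt_le. intros Hlt.
  (* Half the gap between f x s and the infimum - m: a late term near (x, s) would be within [eps]
     of both. *)
  set (eps := (f x s + m) / 2). assert (Heps : 0 < eps) by (unfold eps; lra).
  destruct (Hf x s Hx Hs eps Heps) as [del [Hdel Hd]].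
  destruct (archimed_cor1 eps Heps) as [N [HN HN0]].
  destruct (Hc del N Hdel) as (k & HkN & H1 & H2).
  destruct (Hp k) as (Hk1 & Hk2 & Hk3).
  specialize (Hd _ _ Hk1 Hk2 H1 H2). apply Rabs_def2 in Hd.
  assert (/ (INR k + 1) < eps).
  { apply Rle_lt_trans with (2 := HN).
    apply Rinv_le_contravar; [now apply lt_0_INR|]. apply le_INR in HkN. lra. }
  unfold eps in *. lra.
Qed.

(** * Differentiation along lines *)

Definition line (x xi : vec) (s : R) : vec := fun k => x k + s * xi k.

Lemma line_0 x xi : line x xi 0 = x.
Proof. apply functional_extensionality; intros k. unfold line. ring. Qed.

Lemma line_add x xi s h : line x xi (s + h) = line (line x xi s) xi h.
Proof. apply functional_extensionality; intros k. unfold line. ring. Qed.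

Lemma line_inRn n x xi s : inRn n x -> inRn n xi -> inRn n (line x xi s).
Proof. intros Hx Hxi k Hk. unfold line. rewrite Hx, Hxi by easy. ring. Qed.

Lemma shift_0 x j : shift x j 0 = x.
Proof.
  apply functional_extensionality; intros k. unfold shift.
  destruct (Nat.eqb k j); ring.
Qed.

Lemma shift_add x j r s : shift (shift x j r) j s = shift x j (r + s).
Proof.
  apply functional_extensionality; intros k. unfold shift.
  destruct (Nat.eqb k j); ring.
Qed.

Lemma derivable_pt_lim_translate f s l :
  derivable_pt_lim (fun h => f (s + h)) 0 l -> derivable_pt_lim f s l.
Proof.
  intros H eps Heps. destruct (H eps Heps) as [del Hd]. exists del.
  intros h Hh Hlt. specialize (Hd h Hh Hlt). now rewrite Rplus_0_l, Rplus_0_r in Hd.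
Qed.

Lemma derivable_pt_lim_local_ext f g x l del : 0 < del ->
  (forall s, Rabs (s - x) < del -> f s = g s) ->
  derivable_pt_lim f x l -> derivable_pt_lim g x l.
Proof.
  intros Hdel Hfg Hf. apply is_derive_Reals. apply is_derive_Reals in Hf.
  apply is_derive_ext_loc with f; [|easy].
  exists (mkposreal _ Hdel). intros s Hs. now apply Hfg.
Qed.

Lemma derivable_pt_lim_sumR n (f : nat -> R -> R) (l : nat -> R) x :
  (forall i, (i < n)%nat -> derivable_pt_lim (f i) x (l i)) ->
  derivable_pt_lim (fun s => sumR n (fun i => f i s)) x (sumR n l).
Proof.
  induction n as [|n IH]; intros H; simpl; [apply derivable_pt_lim_const|].
  apply (derivable_pt_lim_plus (fun s => sumR n (fun i => f i s)) (f n));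
    [apply IH; intros; apply H; lia|apply H; lia].
Qed.

Lemma mvt f df a b :
  (forall x, Rmin a b <= x <= Rmax a b -> derivable_pt_lim f x (df x)) ->
  exists c, Rmin a b <= c <= Rmax a b /\ f b - f a = df c * (b - a).
Proof.
  intros H. apply (MVT_gen f a b df).
  - intros x Hx. apply is_derive_Reals, H. lra.
  - intros x Hx. apply derivable_continuous_pt. exists (df x). now apply H.
Qed.

Lemma Rmin_half a b : 0 < a -> 0 < b ->
  0 < Rmin a b / 2 < a /\ Rmin a b / 2 < b.
Proof.
  intros Ha Hb. pose proof (Rmin_l a b). pose proof (Rmin_r a b).
  assert (0 < Rmin a b) by now apply Rmin_pos. lra.
Qed.

Lemma fermat_interior_min g l del : 0 < del ->
  (forall s, Rabs s < del -> g 0 <= g s) -> derivable_pt_lim g 0 l -> l = 0.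
Proof.
  intros Hdel Hmin Hg.
  assert (Hq : forall l', derivable_pt_lim g 0 l' -> ~ 0 < Rabs l').
  { intros l' Hl' Hlt. destruct (Hl' (Rabs l') Hlt) as [d Hd].
    pose proof (cond_pos d) as Hdp.
    set (h0 := Rmin del d / 2).
    assert (Hh0 : 0 < h0 < del /\ h0 < d).
    { apply Rmin_half; lra. }
    (* A step against the sign of l' lowers g: the tolerance |l'| keeps the difference quotient on
       the side of l'. *)
    destruct (Rle_dec 0 l') as [Hl0|Hl0].
    - rewrite (Rabs_pos_eq l') in Hd by easy.
      assert (Ha := Hd (- h0) ltac:(lra) ltac:(rewrite Rabs_Ropp, Rabs_pos_eq; lra)).
      assert (Hb := Hmin (- h0) ltac:(rewrite Rabs_Ropp, Rabs_pos_eq; lra)).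
      rewrite Rplus_0_l in Ha. apply Rabs_def2 in Ha.
      assert (He : (g (- h0) - g 0) = (g (- h0) - g 0) / - h0 * - h0) by (field; lra). nra.
    - rewrite (Rabs_left l') in Hd by lra.
      assert (Ha := Hd h0 ltac:(lra) ltac:(rewrite Rabs_pos_eq; lra)).
      assert (Hb := Hmin h0 ltac:(rewrite Rabs_pos_eq; lra)).
      rewrite Rplus_0_l in Ha. apply Rabs_def2 in Ha.
      assert (He : (g h0 - g 0) = (g h0 - g 0) / h0 * h0) by (field; lra). nra. }
  specialize (Hq l Hg). destruct (Req_dec l 0) as [|Hne]; [easy|].
  exfalso. apply Hq. now apply Rabs_pos_lt.
Qed.

Lemma second_derivative_test g d1 c del : 0 < del ->
  (forall s, Rabs s < del -> g 0 <= g s) ->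
  (forall s, Rabs s < del -> derivable_pt_lim g s (d1 s)) ->
  derivable_pt_lim d1 0 c -> d1 0 = 0 /\ 0 <= c.
Proof.
  intros Hdel Hmin Hg Hd1.
  assert (H0 : d1 0 = 0).
  { eapply fermat_interior_min; eauto. apply Hg. now rewrite Rabs_R0. }
  split; [easy|]. apply Rnot_lt_le. intros Hc.
  destruct (Hd1 (- c) ltac:(lra)) as [d Hd]. pose proof (cond_pos d) as Hdp.
  set (h0 := Rmin del d / 2).
  assert (Hh0 : 0 < h0 < del /\ h0 < d).
  { apply Rmin_half; lra. }
  assert (Hneg : forall s, 0 < s <= h0 -> d1 s < 0).
  { intros s Hs. assert (Ha := Hd s ltac:(lra) ltac:(rewrite Rabs_pos_eq; lra)).
    rewrite Rplus_0_l, H0, Rminus_0_r in Ha. apply Rabs_def2 in Ha.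
    assert (d1 s = d1 s / s * s) by (field; lra). nra. }
  (* The intermediate point of [mvt] may be an endpoint, and d1 vanishes at 0. The half away from 0
     supplies the strict decrease, the other half a weak one. *)
  destruct (mvt g d1 (h0 / 2) h0) as [s [Hs Heq]].
  { intros s. rewrite Rmin_left, Rmax_right by lra. intros Hs. apply Hg. rewrite Rabs_pos_eq; lra. }
  destruct (mvt g d1 0 (h0 / 2)) as [s' [Hs' Heq']].
  { intros s1. rewrite Rmin_left, Rmax_right by lra. intros Hs1. apply Hg. rewrite Rabs_pos_eq; lra. }
  rewrite Rmin_left, Rmax_right in Hs by lra. rewrite Rmin_left, Rmax_right in Hs' by lra.
  specialize (Hmin h0 ltac:(rewrite Rabs_pos_eq; lra)).
  assert (d1 s < 0) by (apply Hneg; lra).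
  assert (d1 s' <= 0).
  { destruct (Req_dec s' 0) as [->|]; [lra|]. left. apply Hneg. lra. }
  nra.
Qed.

(** One-sided, because the minimum over the cylinder may occur at the final time. *)
Lemma left_min_derivative g t l : 0 < t -> derivable_pt_lim g t l ->
  (forall s, 0 <= s <= t -> g t <= g s) -> l <= 0.
Proof.
  intros Ht Hg Hmin. apply Rnot_lt_le. intros Hl.
  destruct (Hg l Hl) as [d Hd]. pose proof (cond_pos d) as Hdp.
  set (h0 := Rmin t d / 2).
  assert (Hh0 : 0 < h0 < t /\ h0 < d).
  { apply Rmin_half; lra. }
  assert (Ha := Hd (- h0) ltac:(lra) ltac:(rewrite Rabs_Ropp, Rabs_pos_eq; lra)).
  assert (Hb := Hmin (t + - h0) ltac:(lra)).
  apply Rabs_def2 in Ha.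
  assert (He : (g (t + - h0) - g t) = (g (t + - h0) - g t) / - h0 * - h0) by (field; lra). nra.
Qed.

Lemma open_near n Om x : is_open_set n Om -> Om x -> exists r, 0 < r /\
  forall y, inRn n y -> (forall i, (i < n)%nat -> Rabs (y i - x i) < r) -> Om y.
Proof.
  intros Ho Hx. destruct (Ho x Hx) as [r [Hr H]].
  exists (r / (INR n + 1)). split; [apply Rdiv_lt_0_compat; pose proof (pos_INR n); lra|].
  intros y Hy Hc. apply H; [easy|]. apply vdist_lt; [easy|]. intros i Hi.
  rewrite Rabs_minus_sym. auto.
Qed.

Lemma open_line n Om x xi : is_open_set n Om -> (forall y, Om y -> inRn n y) ->
  Om x -> inRn n xi ->
  exists r, 0 < r /\ forall s, Rabs s < r -> Om (line x xi s).
Proof.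
  intros Ho HR Hx Hxi. destruct (open_near n Om x Ho Hx) as [r [Hr H]].
  set (X := sumR n (fun i => Rabs (xi i))).
  assert (HX : 0 <= X) by (apply sumR_nonneg; intros; apply Rabs_pos).
  exists (r / (X + 1)). split; [apply Rdiv_lt_0_compat; lra|]. intros s Hs.
  apply H; [apply line_inRn; auto|]. intros i Hi. unfold line.
  replace (x i + s * xi i - x i) with (s * xi i) by ring. rewrite Rabs_mult.
  assert (Rabs (xi i) <= X)
    by (apply (sumR_term_le n (fun i => Rabs (xi i))); auto; intros; apply Rabs_pos).
  assert (r = r / (X + 1) * (X + 1)) by (field; lra).
  assert (0 <= Rabs s) by apply Rabs_pos. nra.
Qed.

(** Only partial derivatives are given. The segment from x to x + s xi is replaced by a staircase
    that moves one coordinate at a time; the mean value theorem on each step and the continuity of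
    [Fx] yield the directional derivative. *)
Lemma chain_rule_line n Om F Fx x xi : is_open_set n Om -> (forall y, Om y -> inRn n y) ->
  (forall y j, Om y -> (j < n)%nat -> pd F y j (Fx j y)) ->
  (forall j, (j < n)%nat -> cont_on n Om (Fx j)) ->
  Om x -> inRn n xi ->
  derivable_pt_lim (fun s => F (line x xi s)) 0 (sumR n (fun j => xi j * Fx j x)).
Proof.
  intros Ho HR HF HFc Hx Hxi.
  (* [tr m] keeps the first m components of xi: the first m steps of the staircase. *)
  set (tr := fun m k => if Nat.ltb k m then xi k else 0).
  set (X := sumR n (fun i => Rabs (xi i))).
  assert (HX : 0 <= X) by (apply sumR_nonneg; intros; apply Rabs_pos).
  assert (HxiX : forall i, Rabs (xi i) <= X).
  { intros i. destruct (Nat.lt_ge_cases i n) as [Hi|Hi].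
    - apply (sumR_term_le n (fun i => Rabs (xi i))); auto; intros; apply Rabs_pos.
    - rewrite Hxi, Rabs_R0; auto. }
  assert (Hclaim : forall m, (m <= n)%nat -> forall eps, 0 < eps -> exists del, 0 < del /\
    forall s, Rabs s < del ->
      Rabs (F (line x (tr m) s) - F x - s * sumR m (fun j => xi j * Fx j x)) <= eps * Rabs s).
  { induction m as [|m IH]; intros Hm eps Heps.
    { exists 1. split; [lra|]. intros s _.
      replace (line x (tr O) s) with x.
      - simpl. replace (F x - F x - s * 0) with 0 by ring. rewrite Rabs_R0.
        apply Rmult_le_pos; [lra|apply Rabs_pos].
      - apply functional_extensionality; intros k. unfold line, tr. simpl. ring. }
    destruct (IH ltac:(lia) (eps / 2) ltac:(lra)) as [d1 [Hd1 Hs1]].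
    assert (He' : 0 < eps / (2 * (X + 1))) by (apply Rdiv_lt_0_compat; lra).
    destruct (HFc m ltac:(lia) x Hx _ He') as [d2 [Hd2 Hs2]].
    destruct (open_near n Om x Ho Hx) as [r [Hr Hopen]].
    (* [q] bounds each coordinate change: below r the staircase stays in Om, below d2 / (n + 1) it
       stays where [Fx m] is within tolerance. *)
    set (q := Rmin r (d2 / (INR n + 1))).
    assert (Hq : 0 < q /\ q <= r /\ q <= d2 / (INR n + 1)).
    { assert (0 < d2 / (INR n + 1)) by (apply Rdiv_lt_0_compat; pose proof (pos_INR n); lra).
      split; [now apply Rmin_pos|split; [apply Rmin_l|apply Rmin_r]]. }
    assert (Hq' : 0 < q / (X + 1)) by (apply Rdiv_lt_0_compat; lra).
    exists (Rmin d1 (q / (X + 1))). split; [now apply Rmin_pos|].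
    intros s Hs.
    assert (Hsd1 : Rabs s < d1) by (eapply Rlt_le_trans; [exact Hs|apply Rmin_l]).
    assert (Hsq : Rabs s < q / (X + 1)) by (eapply Rlt_le_trans; [exact Hs|apply Rmin_r]).
    assert (Hsq' : Rabs s * X < q).
    { assert (q = q / (X + 1) * (X + 1)) by (field; lra). pose proof (Rabs_pos s). nra. }
    specialize (Hs1 s Hsd1).
    set (y := line x (tr m) s) in *.
    assert (Hy : line x (tr (S m)) s = shift y m (s * xi m)).
    { apply functional_extensionality; intros k. unfold y, shift, line, tr.
      destruct (Nat.eqb_spec k m) as [->|Hne].
      - rewrite Nat.ltb_irrefl. replace (m <? S m)%nat with true by (symmetry; apply Nat.ltb_lt; lia). ring.
      - destruct (Nat.ltb_spec k m); destruct (Nat.ltb_spec k (S m)); try lia; ring. }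
    assert (Hin : forall p, Rabs p <= Rabs (s * xi m) ->
      Om (shift y m p) /\ vdist n x (shift y m p) < d2).
    { intros p Hp.
      assert (Hc : forall i, Rabs (shift y m p i - x i) < q).
      { intros i. eapply Rle_lt_trans; [|exact Hsq'].
        apply Rle_trans with (Rabs s * Rabs (xi i)).
        - unfold shift, y, line, tr. destruct (Nat.eqb_spec i m) as [->|Hne].
          + rewrite Nat.ltb_irrefl. rewrite <- Rabs_mult.
            replace (x m + s * 0 + p - x m) with p by ring. easy.
          + rewrite <- Rabs_mult. destruct (Nat.ltb i m).
            * right. f_equal. ring.
            * replace (x i + s * 0 - x i) with 0 by ring. rewrite Rabs_R0. apply Rabs_pos.
        - apply Rmult_le_compat_l; [apply Rabs_pos|auto]. }
      split.
      - apply Hopen; [|intros i _; specialize (Hc i); lra].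
        intros k Hk. unfold shift, y, line, tr. destruct (Nat.eqb_spec k m); [lia|].
        rewrite (HR x Hx k Hk). destruct (Nat.ltb_spec k m); [lia|]. ring.
      - apply vdist_lt; [easy|]. intros i Hi. rewrite Rabs_minus_sym. specialize (Hc i). lra. }
    assert (Hder : forall p, Rabs p <= Rabs (s * xi m) ->
      derivable_pt_lim (fun p => F (shift y m p)) p (Fx m (shift y m p))).
    { intros p Hp. apply derivable_pt_lim_translate.
      destruct (Hin p Hp) as [Hp1 _]. specialize (HF _ m Hp1 ltac:(lia)). unfold pd in HF.
      replace (fun h : R => F (shift y m (p + h))) with (fun h : R => F (shift (shift y m p) m h));
        [easy|].
      apply functional_extensionality; intros h. now rewrite shift_add. }
    assert (Hrange : forall p, Rmin 0 (s * xi m) <= p <= Rmax 0 (s * xi m) -> Rabs p <= Rabs (s * xi m)).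
    { intros p Hp. unfold Rmin, Rmax in Hp. unfold Rabs.
      destruct (Rle_dec 0 (s * xi m)), (Rcase_abs p), (Rcase_abs (s * xi m)); lra. }
    destruct (mvt (fun p => F (shift y m p)) (fun p => Fx m (shift y m p)) 0 (s * xi m))
      as [c [Hc Heq]].
    { intros p Hp. apply Hder, Hrange, Hp. }
    apply Hrange in Hc. destruct (Hin c Hc) as [Hc1 Hc2].
    specialize (Hs2 _ Hc1 Hc2). rewrite shift_0 in Heq.
    rewrite Hy. simpl.
    replace (F (shift y m (s * xi m)) - F x - s * (sumR m (fun j => xi j * Fx j x) + xi m * Fx m x))
      with ((F y - F x - s * sumR m (fun j => xi j * Fx j x))
            + (s * xi m) * (Fx m (shift y m c) - Fx m x)) by lra.
    eapply Rle_trans; [apply Rabs_triang|]. rewrite !Rabs_mult.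
    assert (Rabs (xi m) * Rabs (Fx m (shift y m c) - Fx m x) <= eps / 2).
    { specialize (HxiX m).
      replace (eps / 2) with ((X + 1) * (eps / (2 * (X + 1)))) by (field; lra).
      apply Rmult_le_compat; try apply Rabs_pos; lra. }
    pose proof (Rabs_pos s). nra. }
  intros eps Heps.
  destruct (Hclaim n (le_n n) (eps / 2) ltac:(lra)) as [del [Hdel Hd]].
  exists (mkposreal _ Hdel). intros h Hh Hlt. simpl in Hlt. specialize (Hd h Hlt).
  rewrite line_0, Rplus_0_l.
  replace (tr n) with xi in Hd.
  2: { apply functional_extensionality; intros k. unfold tr.
       destruct (Nat.ltb_spec k n); [easy|now apply Hxi]. }
  replace ((F (line x xi h) - F x) / h - sumR n (fun j => xi j * Fx j x))
    with ((F (line x xi h) - F x - h * sumR n (fun j => xi j * Fx j x)) / h) by (field; easy).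
  unfold Rdiv. rewrite Rabs_mult, Rabs_inv.
  assert (Hah : 0 < Rabs h) by now apply Rabs_pos_lt.
  apply Rle_lt_trans with (eps / 2); [|lra].
  apply Rmult_le_reg_r with (Rabs h); [easy|]. rewrite Rmult_assoc, Rinv_l by lra. lra.
Qed.

Lemma chain_rule_line_at n Om F Fx x xi s : is_open_set n Om -> (forall y, Om y -> inRn n y) ->
  (forall y j, Om y -> (j < n)%nat -> pd F y j (Fx j y)) ->
  (forall j, (j < n)%nat -> cont_on n Om (Fx j)) ->
  Om (line x xi s) -> inRn n xi ->
  derivable_pt_lim (fun s => F (line x xi s)) s (sumR n (fun j => xi j * Fx j (line x xi s))).
Proof.
  intros Ho HR HF HFc Hx Hxi. apply derivable_pt_lim_translate.
  replace (fun h => F (line x xi (s + h))) with (fun h => F (line (line x xi s) xi h))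
    by (apply functional_extensionality; intros h; now rewrite line_add).
  eapply chain_rule_line; eauto.
Qed.

Lemma cont_xt_slice n Om T f t : (forall y, Om y -> inRn n y) -> 0 <= t <= T ->
  cont_xt n Om T f -> cont_on n Om (fun x => f x t).
Proof.
  intros HR Ht Hf x Hx eps Heps.
  destruct (Hf x t (closure_incl n Om x HR Hx) Ht eps Heps) as [del [Hdel Hd]].
  exists del. split; [easy|]. intros y Hy Hxy.
  apply Hd; auto using closure_incl. now rewrite Rminus_diag, Rabs_R0.
Qed.

(** * Comparison principle *)

Lemma cont_xt_const n Om T c : cont_xt n Om T (fun _ _ => c).
Proof.
  intros x t _ _ eps Heps. exists 1. split; [lra|]. intros. now rewrite Rminus_diag, Rabs_R0.
Qed.

Lemma cont_xt_time n Om T : cont_xt n Om T (fun _ t => t).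
Proof. intros x t _ _ eps Heps. exists eps. auto. Qed.

Lemma cont_xt_coord n Om T i : (i < n)%nat -> cont_xt n Om T (fun x _ => x i).
Proof.
  intros Hi x t _ _ eps Heps. exists eps. split; [easy|]. intros y s _ _ Hd _.
  rewrite Rabs_minus_sym. eapply Rle_lt_trans; [|exact Hd]. now apply coord_le_vdist.
Qed.

Lemma cont_xt_plus n Om T f g : cont_xt n Om T f -> cont_xt n Om T g ->
  cont_xt n Om T (fun x t => f x t + g x t).
Proof.
  intros Hf Hg x t Hx Ht eps Heps.
  destruct (Hf x t Hx Ht (eps / 2) ltac:(lra)) as [d1 [Hd1 H1]].
  destruct (Hg x t Hx Ht (eps / 2) ltac:(lra)) as [d2 [Hd2 H2]].
  exists (Rmin d1 d2). split; [now apply Rmin_pos|]. intros y s Hy Hs Hv Hst.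
  pose proof (Rmin_l d1 d2). pose proof (Rmin_r d1 d2).
  replace (f y s + g y s - (f x t + g x t)) with ((f y s - f x t) + (g y s - g x t)) by ring.
  eapply Rle_lt_trans; [apply Rabs_triang|].
  specialize (H1 y s Hy Hs ltac:(lra) ltac:(lra)). specialize (H2 y s Hy Hs ltac:(lra) ltac:(lra)).
  lra.
Qed.

Lemma cont_xt_comp n Om T f (g : R -> R) : continuity g -> cont_xt n Om T f ->
  cont_xt n Om T (fun x t => g (f x t)).
Proof.
  intros Hg Hf x t Hx Ht eps Heps.
  destruct (Hg (f x t) eps Heps) as [d [Hd H]].
  destruct (Hf x t Hx Ht d Hd) as [d' [Hd' H']].
  exists d'. split; [easy|]. intros y s Hy Hs Hv Hst.
  (* [continuity] tests only points different from the base point. *)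
  destruct (Req_dec (f y s) (f x t)) as [->|Hne]; [now rewrite Rminus_diag, Rabs_R0|].
  apply (H (f y s)). split; [split; [exact I|auto]|]. apply H'; auto.
Qed.

Lemma cont_xt_scal n Om T c f : cont_xt n Om T f -> cont_xt n Om T (fun x t => c * f x t).
Proof.
  intros Hf. apply (cont_xt_comp n Om T f (fun v => c * v)); [|easy]. reg.
Qed.

Lemma cont_xt_minus n Om T f g : cont_xt n Om T f -> cont_xt n Om T g ->
  cont_xt n Om T (fun x t => f x t - g x t).
Proof.
  intros Hf Hg.
  replace (fun x t => f x t - g x t) with (fun x t => f x t + (-1) * g x t)
    by (do 2 (apply functional_extensionality; intro); ring).
  apply cont_xt_plus; [easy|now apply cont_xt_scal].
Qed.

(** Polarization reduces products to sums and composition with a function of one variable. *)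
Lemma cont_xt_mult n Om T f g : cont_xt n Om T f -> cont_xt n Om T g ->
  cont_xt n Om T (fun x t => f x t * g x t).
Proof.
  intros Hf Hg.
  assert (Hsq : continuity (fun v => v ^ 2 / 4)) by reg.
  replace (fun x t => f x t * g x t) with
    (fun x t => (f x t + g x t) ^ 2 / 4 - (f x t - g x t) ^ 2 / 4)
    by (do 2 (apply functional_extensionality; intro); field).
  apply cont_xt_minus.
  - apply (cont_xt_comp n Om T (fun x t => f x t + g x t) _ Hsq), cont_xt_plus; easy.
  - apply (cont_xt_comp n Om T (fun x t => f x t - g x t) _ Hsq), cont_xt_minus; easy.
Qed.

Lemma cont_xt_sumR n Om T m (f : nat -> vec -> R -> R) :
  (forall i, (i < m)%nat -> cont_xt n Om T (f i)) ->
  cont_xt n Om T (fun x t => sumR m (fun i => f i x t)).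
Proof.
  induction m as [|m IH]; intros H; simpl; [apply cont_xt_const|].
  apply cont_xt_plus; [apply IH; intros; apply H; lia|apply H; lia].
Qed.

Lemma cont_xt_restrict n Om T tau f : tau <= T -> cont_xt n Om T f -> cont_xt n Om tau f.
Proof.
  intros Htau Hf x t Hx Ht eps Heps.
  destruct (Hf x t Hx ltac:(lra) eps Heps) as [d [Hd H]].
  exists d. split; [easy|]. intros y s Hy Hs. apply H; auto; lra.
Qed.

(** * Second derivatives along lines and the comparison argument *)

Definition quad (n : nat) (M : nat -> nat -> R) (xi : vec) : R :=
  sumR n (fun j => xi j * sumR n (fun k => xi k * M j k)).

Definition pairing (n : nat) (a b : nat -> R) : R := sumR n (fun j => a j * b j).

(** Turns contact in space into a one-variable question. The nesting of the sums in [quad] is the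
    one produced by differentiating the pairing of xi with the gradient. *)
Lemma C21_line_derivatives n Om T f ft fx fxx x t xi :
  is_open_set n Om -> (forall y, Om y -> inRn n y) ->
  C21 n Om T f ft fx fxx -> 0 <= t <= T -> Om x -> inRn n xi ->
  exists r, 0 < r /\ (forall s, Rabs s < r -> Om (line x xi s)) /\
    (forall s, Rabs s < r -> derivable_pt_lim (fun s => f (line x xi s) t) s
       (pairing n xi (fun j => fx j (line x xi s) t))) /\
    derivable_pt_lim (fun s => pairing n xi (fun j => fx j (line x xi s) t)) 0
       (quad n (fun j k => fxx j k x t) xi).
Proof.
  intros Ho HR (H1 & H2 & _ & _ & _ & H3 & H4) Ht Hx Hxi.
  destruct (open_line n Om x xi Ho HR Hx Hxi) as [r [Hr Hin]].
  exists r. split; [easy|]. split; [easy|]. split.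
  - intros s Hs.
    apply (chain_rule_line_at n Om (fun y => f y t) (fun j y => fx j y t)); auto.
    intros j Hj. eapply cont_xt_slice; eauto.
  - apply (derivable_pt_lim_sumR n (fun j s => xi j * fx j (line x xi s) t)
             (fun j => xi j * sumR n (fun k => xi k * fxx j k x t))).
    intros j Hj. apply (derivable_pt_lim_scal (fun s => fx j (line x xi s) t)).
    apply (chain_rule_line n Om (fun y => fx j y t) (fun k y => fxx j k y t)); auto.
    intros k Hk. eapply cont_xt_slice; eauto.
Qed.

Definition unit_vec (i : nat) : vec := fun j => if Nat.eqb j i then 1 else 0.

Lemma unit_vec_inRn n i : (i < n)%nat -> inRn n (unit_vec i).
Proof. intros Hi k Hk. unfold unit_vec. destruct (Nat.eqb_spec k i); [lia|easy]. Qed.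

Lemma pairing_unit_vec n i b : (i < n)%nat -> pairing n (unit_vec i) b = b i.
Proof. intros Hi. now apply sumR_delta. Qed.

(* At a negative minimum of [exp (-(C+1) t) * (e - phi)] the gradients agree,
   the Hessian of [e - phi] is nonnegative and the two differential
   inequalities give [0 <= (e - phi)_t + c (e - phi) < 0]. *)
Lemma comparison n Om T tau C e et ex exx (phi : vec -> R -> R) :
  is_open_set n Om -> is_bounded_set n Om -> (forall y, Om y -> inRn n y) ->
  C21 n Om T e et ex exx -> 0 <= tau < T ->
  cont_xt n Om tau phi ->
  (forall x t, closure n Om x -> 0 <= t <= tau -> e x t < phi x t ->
     Om x /\ 0 < t /\
     exists (rho c : R) (B : nat -> vec) (beta : nat -> R)
            (phit : R) (phix : nat -> R) (Phi : vec -> R),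
       0 < rho /\ Rabs c <= C /\ (forall l, inRn n (B l)) /\
       sumR n (fun l => quad n (fun j k => exx j k x t) (B l))
         + pairing n beta (fun j => ex j x t) <= rho * (et x t + c * e x t) /\
       rho * (phit + c * phi x t) <= sumR n (fun l => Phi (B l)) + pairing n beta phix /\
       derivable_pt_lim (phi x) t phit /\
       (forall xi, inRn n xi -> exists d1 : R -> R,
          (forall s, derivable_pt_lim (fun s => phi (line x xi s) t) s (d1 s)) /\
          d1 0 = pairing n xi phix /\ derivable_pt_lim d1 0 (Phi xi))) ->
  forall x t, closure n Om x -> 0 <= t <= tau -> phi x t <= e x t.
Proof.
  intros Ho Hb HR HC Htau Hphi H x0 t0 Hx0 Ht0.
  assert (HC' := HC). destruct HC' as (_ & _ & Het & Hec & _).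
  (* K + c >= 1 whenever |c| <= C, so the zeroth order term has a strict sign at a negative
     minimum. *)
  set (K := C + 1). set (G := fun x t => exp (- K * t) * (e x t - phi x t)).
  assert (HG : cont_xt n Om tau G).
  { apply cont_xt_mult.
    - apply (cont_xt_comp n Om tau (fun _ t => t) (fun t => exp (- K * t)));
        [reg|apply cont_xt_time].
    - apply cont_xt_minus; [|easy]. apply cont_xt_restrict with T; [lra|easy]. }
  destruct (cont_xt_attains_min n Om tau G Hb ltac:(lra) (ex_intro _ x0 Hx0) HG)
    as (x & t & Hx & Ht & Hmin).
  (* A nonnegative minimum of G already gives the claim; otherwise the minimum point is one to which
     H applies. *)
  destruct (Rle_lt_dec (phi x t) (e x t)) as [Hle|Hlt].
  { specialize (Hmin x0 t0 Hx0 Ht0). unfold G in Hmin.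
    assert (0 < exp (- K * t)) by apply exp_pos. assert (0 < exp (- K * t0)) by apply exp_pos.
    apply Rnot_lt_le. intros Hlt. nra. }
  exfalso.
  destruct (H x t Hx Ht Hlt) as (HOx & Htpos & rho & c & B & beta & phit & phix & Phi & Hrho & Hc &
    HB & Hsup & Hsub & Hpt & Hline).
  assert (Hspace : forall xi, inRn n xi ->
    pairing n xi (fun j => ex j x t) = pairing n xi phix /\
    Phi xi <= quad n (fun j k => exx j k x t) xi).
  { intros xi Hxi.
    destruct (C21_line_derivatives n Om T e et ex exx x t xi Ho HR HC ltac:(lra) HOx Hxi)
      as (r & Hr & Hin & Hd1 & Hd2).
    destruct (Hline xi Hxi) as (d1 & Hp1 & Hp0 & Hp2).
    destruct (second_derivative_test
      (fun s => e (line x xi s) t - phi (line x xi s) t)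
      (fun s => pairing n xi (fun j => ex j (line x xi s) t) - d1 s)
      (quad n (fun j k => exx j k x t) xi - Phi xi) r Hr) as [Ha Hc'].
    - intros s Hs. rewrite line_0.
      specialize (Hmin (line x xi s) t (closure_incl n Om _ HR (Hin s Hs)) Ht).
      unfold G in Hmin. apply Rmult_le_reg_l in Hmin; [easy|apply exp_pos].
    - intros s Hs.
      apply (derivable_pt_lim_minus (fun s => e (line x xi s) t) (fun s => phi (line x xi s) t)); auto.
    - now apply (derivable_pt_lim_minus (fun s => pairing n xi (fun j => ex j (line x xi s) t)) d1).
    - rewrite line_0, Hp0 in Ha. split; lra. }
  (* The coordinate directions recover the single components of the gradient, which the drift
     needs. *)
  assert (Hgrad : pairing n beta (fun j => ex j x t) = pairing n beta phix).
  { apply sumR_ext. intros j Hj. f_equal.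
    destruct (Hspace (unit_vec j) (unit_vec_inRn n j Hj)) as [Heq _].
    now rewrite !pairing_unit_vec in Heq. }
  assert (Hhess : sumR n (fun l => Phi (B l)) <= sumR n (fun l => quad n (fun j k => exx j k x t) (B l))).
  { apply sumR_le. intros l _. now apply Hspace. }
  assert (Htime : et x t - phit <= K * (e x t - phi x t)).
  { assert (Hexp : 0 < exp (- K * t)) by apply exp_pos.
    assert (Hl : (- K * exp (- K * t)) * (e x t - phi x t) + exp (- K * t) * (et x t - phit) <= 0).
    { apply (left_min_derivative (G x) t); [easy| |].
      - apply (derivable_pt_lim_mult (fun t => exp (- K * t)) (fun t => e x t - phi x t)).
        + apply is_derive_Reals. auto_derive; [easy|ring].
        + apply (derivable_pt_lim_minus (e x) (phi x)); [|easy]. apply Het; [easy|lra].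
      - intros s Hs. apply Hmin; [easy|lra]. }
    nra. }
  rewrite Hgrad in Hsup.
  apply Rabs_le_between in Hc.
  assert (0 <= rho * ((et x t - phit) + c * (e x t - phi x t))) by nra.
  assert ((et x t - phit) + c * (e x t - phi x t) < 0) by (unfold K in Htime; nra).
  nra.
Qed.

(** * Gaussian barrier *)

Definition sqdist (n : nat) (x y : vec) : R := sumR n (fun k => (x k - y k) ^ 2).

Lemma sqdist_nonneg n x y : 0 <= sqdist n x y.
Proof. apply sumR_nonneg; intros; apply pow2_ge_0. Qed.

Lemma cont_xt_sqdist n Om T x0 : cont_xt n Om T (fun x _ => sqdist n x x0).
Proof.
  apply (cont_xt_sumR n Om T n (fun k x _ => (x k - x0 k) ^ 2)). intros k Hk.
  apply (cont_xt_comp n Om T (fun x _ => x k) (fun v => (v - x0 k) ^ 2)); [reg|].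
  now apply cont_xt_coord.
Qed.

Lemma sqdist_line n x xi s x0 :
  sqdist n (line x xi s) x0 =
  sqdist n x x0 + 2 * s * pairing n xi (fun k => x k - x0 k) + s ^ 2 * pairing n xi xi.
Proof.
  unfold sqdist, pairing. rewrite <- !sumR_scal, <- !sumR_plus. apply sumR_ext.
  intros k _. unfold line. ring.
Qed.

Lemma vdist_line_small n x xi r : 0 < r ->
  exists s0, 0 < s0 /\ forall s, Rabs s < s0 -> vdist n x (line x xi s) < r.
Proof.
  intros Hr. set (X := sumR n (fun i => Rabs (xi i))).
  assert (HX : 0 <= X) by (apply sumR_nonneg; intros; apply Rabs_pos).
  set (q := r / (INR n + 1)).
  assert (Hq : 0 < q) by (apply Rdiv_lt_0_compat; pose proof (pos_INR n); lra).
  exists (q / (X + 1)). split; [apply Rdiv_lt_0_compat; lra|].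
  intros s Hs. apply vdist_lt; [easy|]. intros i Hi. fold q. unfold line.
  replace (x i - (x i + s * xi i)) with (- (s * xi i)) by ring.
  rewrite Rabs_Ropp, Rabs_mult.
  assert (Rabs (xi i) <= X)
    by (apply (sumR_term_le n (fun i => Rabs (xi i))); auto; intros; apply Rabs_pos).
  assert (q = q / (X + 1) * (X + 1)) by (field; lra).
  assert (0 <= Rabs s) by apply Rabs_pos. nra.
Qed.

(** Minimizing the distance to the complement produces a ball in Om, centred where the energy is
    initially positive, that touches the boundary. *)
Lemma nearest_boundary_point n Om x0 : (1 <= n)%nat -> is_open_set n Om ->
  is_bounded_set n Om -> (forall y, Om y -> inRn n y) -> Om x0 ->
  exists y0, boundary n Om y0 /\ 0 < sqdist n y0 x0 /\
    forall y, inRn n y -> sqdist n y x0 < sqdist n y0 x0 -> Om y.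
Proof.
  intros Hn Ho [M HM] HR Hx0.
  (* The first coordinate of y1 is at least |M| + 1, so y1 lies outside Om. *)
  set (y1 := shift x0 0 (Rabs M + 1 + Rabs (x0 O))).
  assert (Hy1R : inRn n y1).
  { intros k Hk. unfold y1, shift. destruct (Nat.eqb_spec k 0); [lia|]. now apply HR. }
  assert (Hy1 : ~ Om y1).
  { intros Hy. specialize (HM _ Hy).
    assert (Hc := coord_le_vdist n y1 (fun _ => 0) O ltac:(lia)).
    change (y1 O) with (x0 O + (Rabs M + 1 + Rabs (x0 O))) in Hc.
    pose proof (Rle_abs M). pose proof (Rle_abs (- x0 O)) as Hx. rewrite Rabs_Ropp in Hx.
    pose proof (Rle_abs (x0 0%nat + (Rabs M + 1 + Rabs (x0 0%nat)) - 0)). lra. }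
  (* Cutting the complement off at the distance of y1 makes it bounded and loses no candidate for
     the minimum. *)
  set (K := fun y => inRn n y /\ ~ Om y /\ sqdist n y x0 <= sqdist n y1 x0).
  assert (HKR : forall y, K y -> inRn n y) by (now intros y []).
  assert (HKb : is_bounded_set n K).
  { exists (sqrt (2 * sqdist n y1 x0 + 2 * sumR n (fun k => x0 k ^ 2))).
    intros y (_ & _ & Hy). unfold vdist. apply sqrt_le_1_alt.
    apply Rle_trans with (2 * sqdist n y x0 + 2 * sumR n (fun k => x0 k ^ 2)); [|lra].
    unfold sqdist. rewrite <- !sumR_scal, <- sumR_plus. apply sumR_le. intros k _.
    (* 2 (y - x0)^2 + 2 x0^2 - y^2 is the square of y - 2 x0. *)
    pose proof (pow2_ge_0 (y k - 2 * x0 k)). nra. }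
  assert (HKcl : forall y, closure n K y -> inRn n y /\ ~ Om y).
  { intros y [HyR Hy]. split; [easy|]. intros HOy.
    destruct (Ho y HOy) as [r [Hr Hball]]. destruct (Hy r Hr) as [z [(HzR & Hz & _) Hd]].
    apply Hz. now apply Hball. }
  assert (HKy1 : closure n K y1) by (apply closure_incl; [easy|split; [easy|split; [easy|apply Rle_refl]]]).
  (* A time interval of length 0 turns the space-time statement into one about K alone. *)
  destruct (cont_xt_attains_min n K 0 (fun x _ => sqdist n x x0) HKb (Rle_refl 0)
    (ex_intro _ y1 HKy1) (cont_xt_sqdist n K 0 x0)) as (y0 & t & Hy0 & Ht & Hmin).
  destruct (HKcl y0 Hy0) as [Hy0R Hy0O].
  assert (Hmin' : forall y, inRn n y -> ~ Om y -> sqdist n y0 x0 <= sqdist n y x0).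
  { intros y HyR HyO. destruct (Rle_lt_dec (sqdist n y x0) (sqdist n y1 x0)) as [Hle|Hlt].
    - apply (Hmin y 0); [|lra]. now apply closure_incl.
    - specialize (Hmin y1 0 HKy1 ltac:(lra)). simpl in Hmin. lra. }
  assert (Hball : forall y, inRn n y -> sqdist n y x0 < sqdist n y0 x0 -> Om y).
  { intros y HyR Hlt. apply NNPP. intros HyO. specialize (Hmin' y HyR HyO). lra. }
  assert (Hpos : 0 < sqdist n y0 x0).
  { destruct (sqdist_nonneg n y0 x0) as [|Heq]; [easy|]. exfalso. apply Hy0O.
    replace y0 with x0; [easy|]. apply functional_extensionality. intros k.
    destruct (Nat.lt_ge_cases k n) as [Hk|Hk].
    - assert (Hle := coord_le_vdist n y0 x0 k Hk). unfold vdist in Hle.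
      unfold sqdist in Heq. rewrite <- Heq, sqrt_0 in Hle.
      assert (Hz : Rabs (y0 k - x0 k) = 0) by (pose proof (Rabs_pos (y0 k - x0 k)); lra).
      apply Rcomplements.Rabs_eq_0 in Hz. lra.
    - rewrite Hy0R, (HR x0 Hx0) by easy. easy. }
  exists y0. split; [|split; easy]. split; [|easy]. split; [easy|].
  intros r Hr.
  (* Points of the segment from y0 to x0 are closer to x0 than y0 is, hence lie in Om; they show
     that y0 is in the closure. *)
  set (xi := fun k => x0 k - y0 k).
  destruct (vdist_line_small n y0 xi r Hr) as [s0 [Hs0 Hs]].
  destruct (Rmin_half s0 1 Hs0 Rlt_0_1) as [[Ha Hb] Hc]. set (s := Rmin s0 1 / 2) in *.
  exists (line y0 xi s). split; [|apply Hs; rewrite Rabs_pos_eq; lra].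
  assert (HxiR : inRn n xi).
  { intros k Hk. unfold xi. rewrite Hy0R, (HR x0 Hx0) by easy. ring. }
  apply Hball; [now apply line_inRn|].
  replace (sqdist n (line y0 xi s) x0) with ((1 - s) ^ 2 * sqdist n y0 x0).
  { assert ((1 - s) ^ 2 < 1) by nra. nra. }
  unfold sqdist. rewrite <- sumR_scal. apply sumR_ext. intros k _. unfold line, xi. ring.
Qed.

(** [rr] is the initial squared radius and [m] the speed of the squared radius; for positive a and
    eps the function is positive exactly inside that ball. *)
Definition gauss (n : nat) (x0 : vec) (a eps rr m : R) (x : vec) (t : R) : R :=
  eps * (exp (- a * sqdist n x x0) - exp (- a * (rr + m * t))).

Lemma gauss_cont n Om T x0 a eps rr m : cont_xt n Om T (gauss n x0 a eps rr m).
Proof.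
  unfold gauss. apply cont_xt_scal, cont_xt_minus.
  - apply (cont_xt_comp n Om T (fun x _ => sqdist n x x0) (fun v => exp (- a * v)));
      [reg|apply cont_xt_sqdist].
  - apply (cont_xt_comp n Om T (fun _ t => t) (fun t => exp (- a * (rr + m * t))));
      [reg|apply cont_xt_time].
Qed.

Lemma gauss_dt n x0 a eps rr m x t :
  derivable_pt_lim (gauss n x0 a eps rr m x) t (eps * (a * m) * exp (- a * (rr + m * t))).
Proof. unfold gauss. apply is_derive_Reals. auto_derive; [easy|ring]. Qed.

(** Along a line the exponent is a quadratic polynomial in s, so both derivatives are one-variable
    computations. *)
Lemma gauss_line n x0 a eps rr m x t xi :
  let z := fun k => x k - x0 k in
  let E := exp (- a * sqdist n x x0) in
  exists d1 : R -> R,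
    (forall s, derivable_pt_lim (fun s => gauss n x0 a eps rr m (line x xi s) t) s (d1 s)) /\
    d1 0 = pairing n xi (fun j => eps * E * (-2 * a * z j)) /\
    derivable_pt_lim d1 0
      (eps * E * (4 * a ^ 2 * pairing n xi z ^ 2 - 2 * a * pairing n xi xi)).
Proof.
  intros z E. set (q := sqdist n x x0) in *. set (b := pairing n xi z). set (c := pairing n xi xi).
  exists (fun s => eps * exp (- a * (q + 2 * s * b + s ^ 2 * c)) * (- a * (2 * b + 2 * s * c))).
  split; [|split].
  - intros s.
    replace (fun s => gauss n x0 a eps rr m (line x xi s) t) with
      (fun s => eps * (exp (- a * (q + 2 * s * b + s ^ 2 * c)) - exp (- a * (rr + m * t)))).
    + apply is_derive_Reals. auto_derive; [easy|]. simpl. ring.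
    + apply functional_extensionality. intros s'. unfold gauss. now rewrite sqdist_line.
  - replace (pairing n xi (fun j => eps * E * (-2 * a * z j))) with ((eps * E * (-2 * a)) * b).
    + replace (- a * (q + 2 * 0 * b + 0 ^ 2 * c)) with (- a * q) by ring. unfold E. ring.
    + unfold b, pairing. rewrite <- sumR_scal. apply sumR_ext. intros; ring.
  - apply is_derive_Reals. auto_derive; [easy|].
    replace (- a * (q + 2 * 0 * b + 0 * (0 * 1) * c)) with (- a * q) by ring.
    unfold E. ring_simplify. ring.
Qed.

(** After division by eps E, ellipticity and |z|^2 >= rr give a term of at least 4 a^2 theta rr,
    while all others are at most linear in a. The threshold for a collects, in order, the motion of
    the sphere, the zeroth order term, the trace of the second order part and the drift. *)
Lemma gauss_subsolution n (B : nat -> vec) beta z C theta a eps rho c m rr t D :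
  0 < eps -> 0 < rho <= C -> Rabs c <= C -> 0 <= m ->
  (forall l k, (l < n)%nat -> (k < n)%nat -> Rabs (B l k) <= C) ->
  (forall j, (j < n)%nat -> Rabs (beta j) <= C) ->
  theta * pairing n z z <= sumR n (fun l => pairing n (B l) z ^ 2) ->
  0 < theta -> 0 < rr <= pairing n z z -> pairing n z z < rr + m * t -> pairing n z z <= D ->
  1 <= a ->
  C * m + C ^ 2 + 2 * (INR n * (INR n * C ^ 2)) + 2 * (INR n * (C * (1 + D))) <= a * (4 * theta * rr) ->
  let E := exp (- a * pairing n z z) in
  let F := exp (- a * (rr + m * t)) in
  rho * (eps * (a * m) * F + c * (eps * (E - F)))
  <= sumR n (fun l => eps * E * (4 * a ^ 2 * pairing n (B l) z ^ 2 - 2 * a * pairing n (B l) (B l)))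
     + pairing n beta (fun j => eps * E * (-2 * a * z j)).
Proof.
  intros Heps Hrho Hc Hm HB Hbeta Htheta Hth Hrr Hq HD Ha HK E F.
  set (q := pairing n z z) in *.
  assert (HE : 0 < E) by apply exp_pos. assert (HF : 0 < F) by apply exp_pos.
  assert (HFE : F <= E) by (left; apply exp_increasing; nra).
  assert (HC : 0 < C) by lra. apply Rabs_le_between in Hc.
  (* F <= E replaces the time factor by E, so that eps E factors out of both sides. *)
  assert (H1 : rho * (eps * (a * m) * F + c * (eps * (E - F))) <= eps * E * (C * (a * m + C))).
  { apply Rle_trans with (rho * (eps * (E * (a * m + C)))).
    - apply Rmult_le_compat_l; [lra|].
      replace (eps * (a * m) * F + c * (eps * (E - F))) with (eps * (a * m * F + c * (E - F))) by ring.
      apply Rmult_le_compat_l; [lra|].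
      assert (a * m * F <= a * m * E) by (apply Rmult_le_compat_l; nra).
      assert (c * (E - F) <= C * E) by nra. lra.
    - replace (eps * E * (C * (a * m + C))) with (C * (eps * (E * (a * m + C)))) by ring.
      apply Rmult_le_compat_r; [|lra].
      apply Rmult_le_pos; [lra|]. apply Rmult_le_pos; nra. }
  assert (HBB : sumR n (fun l => pairing n (B l) (B l)) <= INR n * (INR n * C ^ 2)).
  { rewrite <- !sumR_const. apply sumR_le. intros l Hl. rewrite sumR_const, <- sumR_const.
    apply sumR_le. intros k Hk. specialize (HB l k Hl Hk). apply Rabs_le_between in HB. nra. }
  assert (Hbz : pairing n beta z <= INR n * (C * (1 + D))).
  { rewrite <- sumR_const. apply sumR_le. intros j Hj. specialize (Hbeta j Hj).
    assert (Hz : z j * z j <= D).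
    { apply Rle_trans with q; [|easy]. apply (sumR_term_le n (fun j => z j * z j)); [|easy].
      intros; nra. }
    eapply Rle_trans; [apply Rle_abs|]. rewrite Rabs_mult.
    apply Rmult_le_compat; try apply Rabs_pos; [easy|].
    (* z_j^2 <= D gives |z_j| <= 1 + D without a square root. *)
    unfold Rabs. destruct (Rcase_abs (z j)); nra. }
  replace (sumR n (fun l => eps * E * (4 * a ^ 2 * pairing n (B l) z ^ 2 - 2 * a * pairing n (B l) (B l))))
    with (eps * E * (4 * a ^ 2 * sumR n (fun l => pairing n (B l) z ^ 2)
                     - 2 * a * sumR n (fun l => pairing n (B l) (B l))))
    by (rewrite sumR_scal, sumR_minus, !sumR_scal; ring).
  replace (pairing n beta (fun j => eps * E * (-2 * a * z j)))
    with (eps * E * (-2 * a * pairing n beta z))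
    by (unfold pairing; rewrite <- !sumR_scal; apply sumR_ext; intros; ring).
  eapply Rle_trans; [exact H1|]. rewrite <- Rmult_plus_distr_l.
  apply Rmult_le_compat_l; [nra|].
  set (SB := sumR n (fun l => pairing n (B l) z ^ 2)) in *.
  set (BB := sumR n (fun l => pairing n (B l) (B l))) in *.
  set (bz := pairing n beta z) in *. set (N1 := INR n * (INR n * C ^ 2)) in *.
  set (N2 := INR n * (C * (1 + D))) in *.
  assert (HSB : theta * rr <= SB) by nra.
  assert (Ha2 : a ^ 2 * (theta * rr) <= a ^ 2 * SB) by (apply Rmult_le_compat_l; nra).
  assert (a * (C * m + C ^ 2 + 2 * N1 + 2 * N2) <= a * (a * (4 * theta * rr)))
    by (apply Rmult_le_compat_l; lra).
  assert (a * BB <= a * N1) by (apply Rmult_le_compat_l; lra).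
  assert (a * bz <= a * N2) by (apply Rmult_le_compat_l; lra).
  assert (C ^ 2 <= a * C ^ 2) by nra.
  nra.
Qed.

(** * Boundary point argument *)

(* [rho (e_t + c e) >= sum_l D^2 e (B_l, B_l) + beta . grad e], where the
   frozen vector fields [B_l] give the operator ellipticity constant [theta]. *)
Definition supersolution (n : nat) (Om : vec -> Prop) (tau C theta : R)
  (e et : vec -> R -> R) (ex : nat -> vec -> R -> R) (exx : nat -> nat -> vec -> R -> R) : Prop :=
  forall x t, Om x -> 0 < t <= tau ->
  exists (rho c : R) (B : nat -> vec) (beta : nat -> R),
    0 < rho <= C /\ Rabs c <= C /\ (forall l, inRn n (B l)) /\
    (forall l k, (l < n)%nat -> (k < n)%nat -> Rabs (B l k) <= C) /\
    (forall j, (j < n)%nat -> Rabs (beta j) <= C) /\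
    (forall z, theta * pairing n z z <= sumR n (fun l => pairing n (B l) z ^ 2)) /\
    sumR n (fun l => quad n (fun j k => exx j k x t) (B l))
      + pairing n beta (fun j => ex j x t) <= rho * (et x t + c * e x t).

(** Comparison with the zero function. A point where e < 0 lies in Om at a positive time: e vanishes
    on the lateral boundary, and the initial values, nonnegative on Om, stay so on the closure by
    continuity. *)
Lemma supersolution_nonneg n Om T tau C theta e et ex exx :
  is_open_set n Om -> is_bounded_set n Om -> (forall y, Om y -> inRn n y) ->
  C21 n Om T e et ex exx -> 0 <= tau < T ->
  supersolution n Om tau C theta e et ex exx ->
  (forall x, Om x -> 0 <= e x 0) ->
  (forall x t, boundary n Om x -> 0 < t <= tau -> e x t = 0) ->
  forall x t, closure n Om x -> 0 <= t <= tau -> 0 <= e x t.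
Proof.
  intros Ho Hb HR HC Htau Hsup He0 Hbd.
  assert (He0' : forall x, closure n Om x -> 0 <= e x 0).
  { intros x Hx. apply Rnot_lt_le. intros Hlt. destruct HC as (_ & _ & _ & Hc & _).
    destruct (Hc x 0 Hx ltac:(lra) (- e x 0) ltac:(lra)) as [d [Hd H]].
    destruct (proj2 Hx d Hd) as [y [Hy Hxy]].
    specialize (H y 0 (closure_incl n Om y HR Hy) ltac:(lra) Hxy
      ltac:(rewrite Rminus_diag, Rabs_R0; lra)).
    apply Rabs_def2 in H. specialize (He0 y Hy). lra. }
  apply (comparison n Om T tau C e et ex exx (fun _ _ => 0)); auto using cont_xt_const.
  intros x t Hx Ht Hneg.
  assert (Htpos : 0 < t).
  { destruct (proj1 Ht) as [|<-]; [easy|]. specialize (He0' x Hx). lra. }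
  assert (HOx : Om x).
  { apply NNPP. intros HOx. rewrite Hbd in Hneg; [lra|now split|lra]. }
  split; [easy|]. split; [easy|].
  destruct (Hsup x t HOx ltac:(lra)) as (rho & c & B & beta & Hrho & Hc & HB & _ & _ & _ & H).
  exists rho, c, B, beta, 0, (fun _ => 0), (fun _ => 0).
  repeat (split; [easy|]). split; [|split].
  - rewrite sumR_const. unfold pairing. rewrite sumR_eq0 by (intros; ring). lra.
  - apply derivable_pt_lim_const.
  - intros xi _. exists (fun _ => 0). split; [intros; apply derivable_pt_lim_const|].
    split; [|apply derivable_pt_lim_const]. symmetry. apply sumR_eq0. intros; ring.
Qed.

(* The spheres |x - x0|^2 = r^2 + m t start inside {e > 0} and reach the
   nearest boundary point exactly at time [t1]. *)
Lemma expanding_ball_bound n Om T tau C theta e et ex exx x0 y0 :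
  is_open_set n Om -> is_bounded_set n Om -> (forall y, Om y -> inRn n y) ->
  C21 n Om T e et ex exx -> 0 < tau < T -> 0 < C -> 0 < theta ->
  supersolution n Om tau C theta e et ex exx ->
  (forall x t, closure n Om x -> 0 <= t <= tau -> 0 <= e x t) ->
  Om x0 -> 0 < e x0 0 -> 0 < sqdist n y0 x0 ->
  (forall y, inRn n y -> sqdist n y x0 < sqdist n y0 x0 -> Om y) ->
  exists t1 a eps, 0 < t1 <= tau /\ 0 < a /\ 0 < eps /\
    forall x, closure n Om x ->
      eps * (exp (- a * sqdist n x x0) - exp (- a * sqdist n y0 x0)) <= e x t1.
Proof.
  intros Ho Hb HR HC Htau HCpos Hth Hsup Hnn Hx0 He0 HD Hball.
  (* Within [del] of (x0, 0) continuity gives e > [eps], while the barrier, having amplitude [eps],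
     stays below [eps]. *)
  set (D := sqdist n y0 x0) in *. set (eps := e x0 0 / 2).
  assert (Hec : cont_xt n Om T e) by apply HC.
  destruct (Hec x0 0 (closure_incl n Om x0 HR Hx0) ltac:(lra) eps ltac:(unfold eps; lra))
    as [del [Hdel Hnear]].
  destruct (Rmin_half tau del ltac:(lra) Hdel) as [[Ht1 Ht2] Ht3].
  set (t1 := Rmin tau del / 2) in *.
  (* The initial ball must lie where e > [eps] and be strictly smaller than the final one. *)
  destruct (Rmin_half D (del ^ 2) HD ltac:(nra)) as [[Hr1 Hr2] Hr3].
  set (rr := Rmin D (del ^ 2) / 2) in *.
  set (m := (D - rr) / t1).
  assert (Hm : 0 < m) by (apply Rdiv_lt_0_compat; lra).
  assert (Hmt : m * t1 = D - rr) by (unfold m; field; lra).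
  (* The threshold of [gauss_subsolution]; the maximum with 1 provides its condition 1 <= a. *)
  set (K0 := C * m + C ^ 2 + 2 * (INR n * (INR n * C ^ 2)) + 2 * (INR n * (C * (1 + D)))).
  set (a := Rmax 1 (K0 / (4 * theta * rr))).
  assert (Ha1 : 1 <= a) by apply Rmax_l.
  assert (Htr : 0 < 4 * theta * rr) by (apply Rmult_lt_0_compat; lra).
  assert (Ha2 : K0 <= a * (4 * theta * rr)).
  { replace K0 with (K0 / (4 * theta * rr) * (4 * theta * rr)) by (field; lra).
    apply Rmult_le_compat_r; [lra|apply Rmax_r]. }
  assert (Heps : 0 < eps) by (unfold eps; lra).
  exists t1, a, eps. split; [lra|]. split; [lra|]. split; [easy|].
  intros x Hx.
  assert (Hmain : forall x t, closure n Om x -> 0 <= t <= t1 ->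
    gauss n x0 a eps rr m x t <= e x t).
  2: { specialize (Hmain x t1 Hx ltac:(lra)). unfold gauss in Hmain.
       replace (rr + m * t1) with D in Hmain by lra. easy. }
  clear x Hx.
  apply (comparison n Om T t1 C e et ex exx); auto using gauss_cont; [lra|].
  intros x t Hx Ht Hlt.
  assert (He : 0 <= e x t) by (apply Hnn; [easy|lra]).
  set (q := sqdist n x x0). set (E := exp (- a * q)). set (F := exp (- a * (rr + m * t))).
  assert (Hw : gauss n x0 a eps rr m x t = eps * (E - F)) by reflexivity.
  assert (HF : 0 < F) by apply exp_pos.
  (* As e >= 0, the barrier is positive where it exceeds e, so the point lies in the expanding
     ball. *)
  assert (HEF : F < E).
  { apply Rnot_le_lt. intros Hle. rewrite Hw in Hlt. nra. }
  assert (Hq : q < rr + m * t).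
  { apply exp_lt_inv in HEF. apply Rnot_le_lt. intros Hle.
    assert (a * (rr + m * t) <= a * q) by (apply Rmult_le_compat_l; lra). lra. }
  assert (HqD : q < D).
  { assert (m * t <= m * t1) by (apply Rmult_le_compat_l; lra). lra. }
  assert (HOx : Om x) by (apply Hball; [apply Hx|easy]).
  (* In the initial ball e > [eps] exceeds the barrier up to time t1. *)
  assert (Hqr : rr <= q).
  { apply Rnot_lt_le. intros Hqr.
    assert (Hd : vdist n x0 x < del).
    { unfold vdist. rewrite <- (sqrt_pow2 del) by lra. apply sqrt_lt_1_alt.
      replace (sumR n (fun k => (x0 k - x k) ^ 2)) with q
        by (apply sumR_ext; intros; ring).
      split; [apply sqdist_nonneg|lra]. }
    specialize (Hnear x t Hx ltac:(lra) Hd ltac:(rewrite Rminus_0_r, Rabs_pos_eq; lra)).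
    apply Rabs_def2 in Hnear.
    assert (E <= 1).
    { rewrite <- exp_0. assert (0 <= a * q) by (apply Rmult_le_pos; [lra|apply sqdist_nonneg]).
      destruct (Req_dec (- a * q) 0) as [Heq|Hne]; [unfold E; rewrite Heq; lra|].
      left. apply exp_increasing. lra. }
    rewrite Hw in Hlt. assert (e x0 0 = 2 * eps) by (unfold eps; lra). nra. }
  split; [easy|]. split.
  (* At t = 0 the shell rr <= q < rr + m t is empty. *)
  { destruct (proj1 Ht) as [|<-]; [easy|]. lra. }
  assert (Htpos : 0 < t) by (destruct (proj1 Ht) as [|<-]; lra).
  destruct (Hsup x t HOx ltac:(lra)) as (rho & c & B & beta & Hrho & Hc & HB & HBC & HbC & Hell & H).
  set (z := fun k => x k - x0 k).
  assert (Hqz : pairing n z z = q) by (apply sumR_ext; intros; unfold z; ring).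
  exists rho, c, B, beta, (eps * (a * m) * F), (fun j => eps * E * (-2 * a * z j)),
    (fun xi => eps * E * (4 * a ^ 2 * pairing n xi z ^ 2 - 2 * a * pairing n xi xi)).
  split; [easy|]. split; [easy|]. split; [easy|]. split; [easy|].
  split; [|split; [apply gauss_dt|]].
  - rewrite Hw. unfold E. rewrite <- Hqz.
    apply (gauss_subsolution n B beta z C theta a eps rho c m rr t D); auto; try lra; rewrite Hqz; lra.
  - intros xi _. apply gauss_line.
Qed.

(** [ex] at y0 is only a continuous extension from Om, so the contradiction is drawn on an interior
    piece [s', s] of the segment: there the slope is below k / 4 and e at s' is below k s / 4,
    against e > k s at s. *)
Lemma no_flat_supersolution n Om T tau C theta e et ex exx :
  (1 <= n)%nat -> is_open_set n Om -> is_bounded_set n Om -> (forall y, Om y -> inRn n y) ->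
  C21 n Om T e et ex exx -> 0 < tau < T -> 0 < C -> 0 < theta ->
  supersolution n Om tau C theta e et ex exx ->
  (forall x, Om x -> 0 <= e x 0) -> (exists x, Om x /\ 0 < e x 0) ->
  (forall x t, boundary n Om x -> 0 < t <= tau ->
     e x t = 0 /\ forall j, (j < n)%nat -> ex j x t = 0) -> False.
Proof.
  intros Hn Ho Hb HR HC Htau HCp Hth Hsup He0 [x0 [Hx0 Hpos]] Hbd.
  assert (Hnn : forall x t, closure n Om x -> 0 <= t <= tau -> 0 <= e x t).
  { apply (supersolution_nonneg n Om T tau C theta e et ex exx); auto; [lra|].
    intros; now apply Hbd. }
  destruct (nearest_boundary_point n Om x0 Hn Ho Hb HR Hx0) as (y0 & Hy0 & HD & Hball).
  destruct (expanding_ball_bound n Om T tau C theta e et ex exx x0 y0)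
    as (t1 & a & eps & Ht1 & Ha & Heps & Hbound); auto.
  set (D := sqdist n y0 x0) in *.
  set (xi := fun k => x0 k - y0 k).
  assert (HxiR : inRn n xi).
  { intros k Hk. unfold xi. rewrite (proj1 (proj1 Hy0) k Hk), (HR x0 Hx0 k Hk). ring. }
  assert (Hsq : forall s, sqdist n (line y0 xi s) x0 = (1 - s) ^ 2 * D).
  { intros s. unfold D, sqdist. rewrite <- sumR_scal. apply sumR_ext. intros k _. unfold line, xi. ring. }
  assert (HOl : forall s, 0 < s < 1 -> Om (line y0 xi s)).
  { intros s Hs. apply Hball; [apply line_inRn; [apply Hy0|easy]|].
    rewrite Hsq. assert ((1 - s) ^ 2 < 1) by nra. nra. }
  destruct (Hbd y0 t1 Hy0 Ht1) as [Hey0 Hexy0].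
  (* Slope of the barrier at y0 from below: exp u >= 1 + u with u = a D s (2 - s), and 2 - s > 1. *)
  set (k := eps * exp (- a * D) * (a * D)).
  assert (Hk : 0 < k).
  { assert (0 < exp (- a * D)) by apply exp_pos. unfold k.
    repeat apply Rmult_lt_0_compat; easy. }
  assert (Hlow : forall s, 0 < s < 1 -> k * s < e (line y0 xi s) t1).
  { intros s Hs. eapply Rlt_le_trans; [|apply Hbound, closure_incl; auto].
    rewrite Hsq. unfold k.
    replace (- a * ((1 - s) ^ 2 * D)) with (- a * D + a * D * (s * (2 - s))) by ring.
    rewrite exp_plus. set (G := exp (- a * D)). assert (HG : 0 < G) by apply exp_pos.
    assert (HaD : 0 < a * D) by (apply Rmult_lt_0_compat; easy).
    pose proof (exp_ineq1_le (a * D * (s * (2 - s)))) as Hexp.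
    replace (eps * (G * exp (a * D * (s * (2 - s))) - G))
      with (eps * G * (exp (a * D * (s * (2 - s))) - 1)) by ring.
    rewrite (Rmult_assoc (eps * G)). apply Rmult_lt_compat_l; [now apply Rmult_lt_0_compat|].
    assert (a * D * s < a * D * (s * (2 - s))) by (apply Rmult_lt_compat_l; nra). lra. }
  assert (Hgc : cont_xt n Om T (fun x t => pairing n xi (fun j => ex j x t))).
  { apply (cont_xt_sumR n Om T n (fun j x t => xi j * ex j x t)). intros j Hj.
    apply cont_xt_scal. now apply HC. }
  assert (Hec : cont_xt n Om T e) by apply HC.
  destruct (Hgc y0 t1 (proj1 Hy0) ltac:(lra) (k / 4) ltac:(lra)) as [d1 [Hd1 H1]].
  destruct (vdist_line_small n y0 xi d1 Hd1) as [s1 [Hs1 Hv1]].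
  destruct (Rmin_half s1 1 Hs1 Rlt_0_1) as [[Hsa Hsb] Hsc]. set (s := Rmin s1 1 / 2) in *.
  assert (Hks : 0 < k * s) by now apply Rmult_lt_0_compat.
  (* The tolerance k s / 4 depends on s, so s' is chosen after s. *)
  destruct (Hec y0 t1 (proj1 Hy0) ltac:(lra) (k * s / 4) ltac:(lra)) as [d2 [Hd2 H2]].
  destruct (vdist_line_small n y0 xi d2 Hd2) as [s2 [Hs2 Hv2]].
  destruct (Rmin_half s2 s Hs2 Hsa) as [[Hsa' Hsb'] Hsc']. set (s' := Rmin s2 s / 2) in *.
  assert (Hin : forall r, 0 < r < 1 -> closure n Om (line y0 xi r))
    by (intros; apply closure_incl; auto).
  destruct (mvt (fun r => e (line y0 xi r) t1)
    (fun r => pairing n xi (fun j => ex j (line y0 xi r) t1)) s' s) as [r [Hr Heq]].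
  { intros r. rewrite Rmin_left, Rmax_right by lra. intros Hr.
    destruct HC as (Hp1 & _ & _ & _ & _ & Hp2 & _).
    apply (chain_rule_line_at n Om (fun y => e y t1) (fun j y => ex j y t1)); auto.
    - intros y j Hy Hj. apply Hp1; auto; lra.
    - intros j Hj. apply (cont_xt_slice n Om T); auto; lra.
    - apply HOl; lra. }
  rewrite Rmin_left, Rmax_right in Hr by lra.
  specialize (H1 (line y0 xi r) t1 (Hin r ltac:(lra)) ltac:(lra)
    ltac:(apply Hv1; rewrite Rabs_pos_eq; lra) ltac:(rewrite Rminus_diag, Rabs_R0; lra)).
  replace (pairing n xi (fun j => ex j y0 t1)) with 0 in H1
    by (symmetry; apply sumR_eq0; intros j Hj; rewrite Hexy0 by easy; ring).
  specialize (H2 (line y0 xi s') t1 (Hin s' ltac:(lra)) ltac:(lra)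
    ltac:(apply Hv2; rewrite Rabs_pos_eq; lra) ltac:(rewrite Rminus_diag, Rabs_R0; lra)).
  rewrite Hey0 in H2. apply Rabs_def2 in H1. apply Rabs_def2 in H2.
  specialize (Hlow s ltac:(lra)). simpl in Heq. nra.
Qed.

(** * Coefficients of the energy equation *)

Definition krond (i j : nat) : R := if Nat.eqb i j then 1 else 0.

Lemma detR_succ m A :
  detR (S m) A = sumR (S m) (fun j => (-1) ^ j * A O j * detR m (minor O j A)).
Proof. reflexivity. Qed.

Lemma detR_ext m A B : (forall i j, (i < m)%nat -> (j < m)%nat -> A i j = B i j) ->
  detR m A = detR m B.
Proof.
  revert A B. induction m as [|m IH]; intros A B H; [easy|].
  rewrite !detR_succ. apply (sumR_ext (S m)). intros j Hj. rewrite H by lia. f_equal.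
  apply IH. intros r c Hr Hc. unfold minor, skip.
  apply H; [destruct (Nat.ltb r 0)|destruct (Nat.ltb c j)]; lia.
Qed.

Lemma detR_zero_row m A r : (r < m)%nat -> (forall c, (c < m)%nat -> A r c = 0) -> detR m A = 0.
Proof.
  revert A r. induction m as [|m IH]; intros A r Hr H; [lia|].
  rewrite detR_succ. apply (sumR_eq0 (S m)). intros j Hj. destruct r as [|r].
  - rewrite H by lia. ring.
  - rewrite (IH (minor 0 j A) r); [ring|lia|].
    intros c Hc. unfold minor, skip. simpl. apply H. destruct (Nat.ltb c j); lia.
Qed.

Lemma detR_krond m : detR m krond = 1.
Proof.
  induction m as [|m IH]; [easy|].
  rewrite detR_succ.
  transitivity (sumR (S m) (fun j => krond j 0 * ((-1) ^ j * detR m (minor 0 j krond)))).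
  - apply (sumR_ext (S m)). intros j _. unfold krond at 1 3. rewrite Nat.eqb_sym. ring.
  - unfold krond at 1. rewrite sumR_delta by lia. simpl. rewrite Rmult_1_l, <- IH at 1.
    now apply detR_ext.
Qed.

Lemma cofactor_krond n i j : (i < n)%nat -> (j < n)%nat -> cofactor n krond i j = krond i j.
Proof.
  intros Hi Hj. unfold cofactor, krond at 2.
  destruct (Nat.eqb_spec i j) as [->|Hne].
  - rewrite (detR_ext _ _ krond), detR_krond.
    + replace (j + j)%nat with (2 * j)%nat by lia. rewrite pow_1_even. ring.
    + intros r c _ _. unfold minor, krond, skip.
      destruct (Nat.ltb_spec r j), (Nat.ltb_spec c j);
        repeat match goal with |- context [Nat.eqb ?a ?b] => destruct (Nat.eqb_spec a b) end;
        lia || easy.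
  (* Deleting column j removes the only nonzero entry of row j; that row survives in the minor with
     index j or j - 1, according to whether j < i. *)
  - rewrite (detR_zero_row _ _ (if Nat.ltb j i then j else (j - 1)%nat)); [ring| |].
    + destruct (Nat.ltb_spec j i); lia.
    + intros c _. unfold minor, krond, skip.
      replace (if Nat.ltb (if Nat.ltb j i then j else (j - 1)%nat) i
               then if Nat.ltb j i then j else (j - 1)%nat
               else S (if Nat.ltb j i then j else (j - 1)%nat)) with j.
      * destruct (Nat.ltb_spec c j); [destruct (Nat.eqb_spec j c)|destruct (Nat.eqb_spec j (S c))];
          lia || easy.
      * destruct (Nat.ltb_spec j i); [destruct (Nat.ltb_spec j i)|destruct (Nat.ltb_spec (j - 1) i)]; lia.
Qed.

(* [P f c] also carries a scalar attached to [f] (a limit) through the determinant. *)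
Definition subalgebra (P : (vec -> R -> R) -> R -> Prop) : Prop :=
  (forall c, P (fun _ _ => c) c) /\
  (forall f g a b, P f a -> P g b -> P (fun x t => f x t + g x t) (a + b)) /\
  (forall f g a b, P f a -> P g b -> P (fun x t => f x t * g x t) (a * b)).

Lemma subalgebra_sumR P m (f : nat -> vec -> R -> R) (L : nat -> R) : subalgebra P ->
  (forall i, (i < m)%nat -> P (f i) (L i)) -> P (fun x t => sumR m (fun i => f i x t)) (sumR m L).
Proof.
  intros (Pconst & Pplus & _).
  induction m as [|m IH]; intros H; simpl; [apply Pconst|].
  apply Pplus; [apply IH; intros; apply H; lia|apply H; lia].
Qed.

(** A determinant is a polynomial in its entries. One induction thus serves both bounded
    differentiability and the limit at t = 0. *)
Lemma subalgebra_detR P m (A : nat -> nat -> vec -> R -> R) (L : nat -> nat -> R) : subalgebra P ->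
  (forall i j, (i < m)%nat -> (j < m)%nat -> P (A i j) (L i j)) ->
  P (fun x t => detR m (fun i j => A i j x t)) (detR m L).
Proof.
  intros HP. assert (HP' := HP). destruct HP' as (Pconst & _ & Pmult).
  revert A L. induction m as [|m IH]; intros A L H; [apply (Pconst 1)|].
  apply (subalgebra_sumR P (S m)
    (fun j x t => (-1) ^ j * A O j x t * detR m (minor O j (fun i j => A i j x t)))
    (fun j => (-1) ^ j * L O j * detR m (minor O j L)) HP).
  intros j Hj. apply Pmult.
  { apply Pmult; [apply Pconst|apply H; lia]. }
  apply (IH (fun r c => A (skip 0 r) (skip j c)) (minor 0 j L)).
  intros r c Hr Hc. unfold minor, skip.
  apply H; [destruct (Nat.ltb r 0)|destruct (Nat.ltb c j)]; lia.
Qed.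

Lemma subalgebra_cofactor P n (A : nat -> nat -> vec -> R -> R) (L : nat -> nat -> R) i j :
  subalgebra P -> (i < n)%nat -> (j < n)%nat ->
  (forall i j, (i < n)%nat -> (j < n)%nat -> P (A i j) (L i j)) ->
  P (fun x t => cofactor n (fun i j => A i j x t) i j) (cofactor n L i j).
Proof.
  intros HP Hi Hj H. assert (HP' := HP). destruct HP' as (Pconst & _ & Pmult).
  unfold cofactor. apply Pmult; [apply Pconst|].
  apply (subalgebra_detR P (n - 1) (fun r c => A (skip i r) (skip j c)) (minor i j L) HP).
  intros r c Hr Hc. unfold minor, skip.
  apply H; [destruct (Nat.ltb r i)|destruct (Nat.ltb c j)]; lia.
Qed.

(** * Bounded coefficients with bounded spatial derivatives *)

Definition bdd (Om : vec -> Prop) (tau : R) (f : vec -> R -> R) : Prop :=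
  exists M, forall x t, Om x -> 0 <= t <= tau -> Rabs (f x t) <= M.

Lemma bdd_const Om tau c : bdd Om tau (fun _ _ => c).
Proof. exists (Rabs c). intros; lra. Qed.

Lemma bdd_plus Om tau f g : bdd Om tau f -> bdd Om tau g -> bdd Om tau (fun x t => f x t + g x t).
Proof.
  intros [M HM] [N HN]. exists (M + N). intros x t Hx Ht.
  eapply Rle_trans; [apply Rabs_triang|]. specialize (HM x t Hx Ht). specialize (HN x t Hx Ht). lra.
Qed.

Lemma bdd_mult Om tau f g : bdd Om tau f -> bdd Om tau g -> bdd Om tau (fun x t => f x t * g x t).
Proof.
  intros [M HM] [N HN]. exists (M * N). intros x t Hx Ht. rewrite Rabs_mult.
  apply Rmult_le_compat; try apply Rabs_pos; auto.
Qed.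

Lemma bdd_sumR Om tau m (f : nat -> vec -> R -> R) : (forall i, (i < m)%nat -> bdd Om tau (f i)) ->
  bdd Om tau (fun x t => sumR m (fun i => f i x t)).
Proof.
  intros H. apply (subalgebra_sumR (fun f _ => bdd Om tau f) m f (fun _ => 0)); [|easy].
  split; [apply bdd_const|]. split; intros; [now apply bdd_plus|now apply bdd_mult].
Qed.

Lemma bdd_cont_xt n Om T tau f : (forall y, Om y -> inRn n y) -> is_bounded_set n Om ->
  tau <= T -> cont_xt n Om T f -> bdd Om tau f.
Proof.
  intros HR Hb Htau Hf. destruct (cont_xt_bounded n Om T f Hb Hf) as [M HM].
  exists M. intros x t Hx Ht. apply HM; [now apply closure_incl|lra].
Qed.

Lemma bdd_uniform Om tau n (f : nat -> vec -> R -> R) :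
  (forall j, (j < n)%nat -> bdd Om tau (f j)) ->
  exists M, forall x t j, Om x -> 0 <= t <= tau -> (j < n)%nat -> Rabs (f j x t) <= M.
Proof.
  induction n as [|n IH]; intros H; [exists 0; intros; lia|].
  destruct IH as [M HM]; [intros; apply H; lia|]. destruct (H n ltac:(lia)) as [N HN].
  exists (Rmax M N). intros x t j Hx Ht Hj. destruct (Nat.eq_dec j n) as [->|Hne].
  - eapply Rle_trans; [now apply HN|apply Rmax_r].
  - eapply Rle_trans; [apply HM; auto; lia|apply Rmax_l].
Qed.

(** Bounds on the derivatives suffice: they enter only through the drift, where J^-1 b is
    differentiated once. *)
Definition bdd_C1 (n : nat) (Om : vec -> Prop) (tau : R) (f : vec -> R -> R) : Prop :=
  bdd Om tau f /\ exists D : nat -> vec -> R -> R, forall k, (k < n)%nat -> bdd Om tau (D k) /\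
    forall x t, Om x -> 0 <= t <= tau -> pd (fun y => f y t) x k (D k x t).

Lemma bdd_C1_const n Om tau c : bdd_C1 n Om tau (fun _ _ => c).
Proof.
  split; [apply bdd_const|]. exists (fun _ _ _ => 0). intros k _. split; [apply bdd_const|].
  intros x t _ _. apply derivable_pt_lim_const.
Qed.

Lemma pd_plus f g x k a b : pd f x k a -> pd g x k b -> pd (fun y => f y + g y) x k (a + b).
Proof. apply (derivable_pt_lim_plus (fun s => f (shift x k s)) (fun s => g (shift x k s))). Qed.

Lemma pd_mult f g x k a b : pd f x k a -> pd g x k b ->
  pd (fun y => f y * g y) x k (a * g x + f x * b).
Proof.
  intros Hf Hg.
  assert (H := derivable_pt_lim_mult (fun s => f (shift x k s)) (fun s => g (shift x k s)) 0 a b Hf Hg).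
  cbv beta in H. now rewrite shift_0 in H.
Qed.

Lemma pd_inv f x k a : f x <> 0 -> pd f x k a -> pd (fun y => / f y) x k (- a * (/ f x * / f x)).
Proof.
  intros Hne Hf. unfold pd in *. apply is_derive_Reals. apply is_derive_Reals in Hf.
  assert (Hne' : f (shift x k 0) <> 0) by now rewrite shift_0.
  assert (H := is_derive_inv (fun s => f (shift x k s)) 0 a Hf Hne').
  simpl in H. rewrite shift_0 in H.
  replace (- a * (/ f x * / f x)) with (- a / f x ^ 2) by (field; easy). exact H.
Qed.

Lemma bdd_C1_plus n Om tau f g : bdd_C1 n Om tau f -> bdd_C1 n Om tau g ->
  bdd_C1 n Om tau (fun x t => f x t + g x t).
Proof.
  intros [Hf [D HD]] [Hg [D' HD']]. split; [now apply bdd_plus|].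
  exists (fun k x t => D k x t + D' k x t). intros k Hk.
  destruct (HD k Hk) as [H1 H2]. destruct (HD' k Hk) as [H3 H4].
  split; [now apply bdd_plus|]. intros x t Hx Ht. now apply pd_plus; auto.
Qed.

Lemma bdd_C1_mult n Om tau f g : bdd_C1 n Om tau f -> bdd_C1 n Om tau g ->
  bdd_C1 n Om tau (fun x t => f x t * g x t).
Proof.
  intros [Hf [D HD]] [Hg [D' HD']]. split; [now apply bdd_mult|].
  exists (fun k x t => D k x t * g x t + f x t * D' k x t). intros k Hk.
  destruct (HD k Hk) as [H1 H2]. destruct (HD' k Hk) as [H3 H4].
  split; [apply bdd_plus; now apply bdd_mult|]. intros x t Hx Ht.
  apply (pd_mult (fun y => f y t) (fun y => g y t)); auto.
Qed.

Lemma bdd_C1_inv n Om tau f d : 0 < d ->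
  (forall x t, Om x -> 0 <= t <= tau -> d <= f x t) -> bdd_C1 n Om tau f ->
  bdd_C1 n Om tau (fun x t => / f x t).
Proof.
  intros Hd Hf [_ [D HD]].
  assert (Hb : bdd Om tau (fun x t => / f x t)).
  { exists (/ d). intros x t Hx Ht. specialize (Hf x t Hx Ht).
    rewrite Rabs_pos_eq; [apply Rinv_le_contravar; lra|].
    left. apply Rinv_0_lt_compat. lra. }
  split; [easy|]. exists (fun k x t => - D k x t * (/ f x t * / f x t)). intros k Hk.
  destruct (HD k Hk) as [H1 H2]. split.
  - apply bdd_mult; [|now apply bdd_mult].
    destruct H1 as [M HM]. exists M. intros. rewrite Rabs_Ropp. auto.
  - intros x t Hx Ht. specialize (Hf x t Hx Ht).
    apply (pd_inv (fun y => f y t)); [lra|auto].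
Qed.

(** * Limits at t = 0 uniform in space, dissipation and ellipticity *)

Definition tends_at_initial (Om : vec -> Prop) (T : R) (f : vec -> R -> R) (c : R) : Prop :=
  forall eps, 0 < eps -> exists tau, 0 < tau /\
    forall x t, Om x -> 0 <= t <= T -> t <= tau -> Rabs (f x t - c) < eps.

Lemma tends_at_initial_const Om T c : tends_at_initial Om T (fun _ _ => c) c.
Proof. intros eps Heps. exists 1. split; [lra|]. intros. now rewrite Rminus_diag, Rabs_R0. Qed.

Lemma tends_at_initial_plus Om T f g a b : tends_at_initial Om T f a -> tends_at_initial Om T g b ->
  tends_at_initial Om T (fun x t => f x t + g x t) (a + b).
Proof.
  intros Hf Hg eps Heps.
  destruct (Hf (eps / 2) ltac:(lra)) as [t1 [Ht1 H1]].
  destruct (Hg (eps / 2) ltac:(lra)) as [t2 [Ht2 H2]].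
  exists (Rmin t1 t2). split; [now apply Rmin_pos|]. intros x t Hx Ht Hle.
  pose proof (Rmin_l t1 t2). pose proof (Rmin_r t1 t2).
  specialize (H1 x t Hx Ht ltac:(lra)). specialize (H2 x t Hx Ht ltac:(lra)).
  apply Rabs_def2 in H1. apply Rabs_def2 in H2. apply Rabs_def1; lra.
Qed.

Lemma tends_at_initial_mult Om T f g a b : tends_at_initial Om T f a -> tends_at_initial Om T g b ->
  tends_at_initial Om T (fun x t => f x t * g x t) (a * b).
Proof.
  intros Hf Hg eps Heps.
  (* With both deviations below d <= 1, the error of the product is below d (1 + |a| + |b|). *)
  set (q := 1 + Rabs a + Rabs b).
  assert (Hq : 0 < q) by (pose proof (Rabs_pos a); pose proof (Rabs_pos b); unfold q; lra).
  set (d := Rmin 1 (eps / q)).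
  assert (Hd : 0 < d) by (apply Rmin_pos; [lra|now apply Rdiv_lt_0_compat]).
  destruct (Hf d Hd) as [t1 [Ht1 H1]]. destruct (Hg d Hd) as [t2 [Ht2 H2]].
  exists (Rmin t1 t2). split; [now apply Rmin_pos|]. intros x t Hx Ht Hle.
  pose proof (Rmin_l t1 t2). pose proof (Rmin_r t1 t2).
  specialize (H1 x t Hx Ht ltac:(lra)). specialize (H2 x t Hx Ht ltac:(lra)).
  replace (f x t * g x t - a * b)
    with ((f x t - a) * (g x t - b) + a * (g x t - b) + b * (f x t - a)) by ring.
  assert (Hd1 : d <= 1) by apply Rmin_l.
  assert (Hdq : d * q <= eps).
  { replace eps with (eps / q * q) by (field; lra). apply Rmult_le_compat_r; [lra|apply Rmin_r]. }
  eapply Rle_lt_trans; [apply Rabs_triang|].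
  eapply Rle_lt_trans; [apply Rplus_le_compat_r, Rabs_triang|]. rewrite !Rabs_mult.
  pose proof (Rabs_pos (f x t - a)). pose proof (Rabs_pos (g x t - b)).
  pose proof (Rabs_pos a). pose proof (Rabs_pos b).
  assert (Rabs (f x t - a) * Rabs (g x t - b) < d) by nra.
  unfold q in Hdq. nra.
Qed.

(** The diagonal terms alone give a double sum of at least 4 Q, and tr^2 <= n Q by Cauchy-Schwarz.
    Multiplied by n, the expression is then at least (2 mu + n lam) tr^2, whatever the sign of
    lam. *)
Lemma viscous_dissipation_nonneg n mu lam (A : nat -> nat -> R) :
  (1 <= n)%nat -> 0 < mu -> 0 <= 2 * mu + INR n * lam ->
  0 <= mu / 2 * sumR n (fun i => sumR n (fun l => (A i l + A l i) ^ 2))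
       + lam * sumR n (fun i => A i i) ^ 2.
Proof.
  intros Hn Hmu Hlam. apply le_INR in Hn. simpl in Hn.
  set (tr := sumR n (fun i => A i i)). set (Q := sumR n (fun i => A i i ^ 2)).
  assert (Hcs : tr ^ 2 <= INR n * Q) by apply sumR_sqr_le.
  assert (Hdiag : 4 * Q <= sumR n (fun i => sumR n (fun l => (A i l + A l i) ^ 2))).
  { unfold Q. rewrite <- sumR_scal. apply sumR_le. intros i Hi.
    replace (4 * A i i ^ 2) with ((A i i + A i i) ^ 2) by ring.
    apply (sumR_term_le n (fun l => (A i l + A l i) ^ 2)); [|easy].
    intros; apply pow2_ge_0. }
  set (S := sumR n _) in *.
  assert (Htr : 0 <= tr ^ 2) by apply pow2_ge_0.
  apply Rle_trans with (2 * mu * Q + lam * tr ^ 2); [|nra].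
  apply Rmult_le_reg_l with (INR n); [lra|].
  assert (0 <= (2 * mu + INR n * lam) * tr ^ 2) by now apply Rmult_le_pos.
  nra.
Qed.

(* [B = I + eta] with [n |eta|^2 <= 1/4]: each component satisfies
   [(B_l z)^2 >= z_l^2 / 2 - (eta_l z)^2]. *)
Lemma near_identity_elliptic n (B : nat -> nat -> R) z :
  INR n * sumR n (fun l => sumR n (fun k => (B l k - krond l k) * (B l k - krond l k))) <= / 4 ->
  / 4 * pairing n z z <= sumR n (fun l => pairing n (B l) z ^ 2).
Proof.
  intros H. set (f := sumR n _) in H.
  assert (Hzz : 0 <= pairing n z z) by (apply sumR_nonneg; intros; nra).
  set (er := fun l => sumR n (fun k => (B l k - krond l k) * z k)).
  assert (Her : sumR n (fun l => er l ^ 2) <= INR n * f * pairing n z z).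
  { apply Rle_trans with
      (sumR n (fun l => INR n * sumR n (fun k => (B l k - krond l k) * (B l k - krond l k)) * pairing n z z)).
    - apply sumR_le. intros l _. eapply Rle_trans; [apply sumR_sqr_le|].
      rewrite Rmult_assoc. apply Rmult_le_compat_l; [apply pos_INR|].
      rewrite Rmult_comm, <- sumR_scal. apply sumR_le. intros k Hk.
      assert (z k * z k <= pairing n z z)
        by (apply (sumR_term_le n (fun k => z k * z k)); [intros; nra|easy]).
      pose proof (pow2_ge_0 (B l k - krond l k)). nra.
    - right. unfold f. rewrite (Rmult_comm _ (pairing n z z)), <- !sumR_scal.
      apply sumR_ext. intros; ring. }
  (* The error takes at most 1/4 of |z|^2 from 1/2, which leaves the ellipticity constant 1/4. *)
  apply Rle_trans with (/ 2 * pairing n z z - sumR n (fun l => er l ^ 2)); [nra|].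
  unfold pairing at 1. rewrite <- sumR_scal, <- sumR_minus. apply sumR_le. intros l Hl.
  replace (pairing n (B l) z) with (er l + z l).
  (* (er + z)^2 - z^2 / 2 + er^2 is half the square of 2 er + z. *)
  - pose proof (pow2_ge_0 (2 * er l + z l)). nra.
  - rewrite <- (sumR_delta n l z Hl). unfold er, pairing. rewrite <- sumR_plus. apply sumR_ext.
    intros k _. unfold krond. rewrite (Nat.eqb_sym l k). ring.
Qed.

Lemma subalgebra_bdd_C1 n Om tau : subalgebra (fun f _ => bdd_C1 n Om tau f).
Proof.
  split; [intros; apply bdd_C1_const|].
  split; intros; [now apply bdd_C1_plus|now apply bdd_C1_mult].
Qed.

Lemma subalgebra_tends_at_initial Om T : subalgebra (tends_at_initial Om T).
Proof.
  split; [apply tends_at_initial_const|].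
  split; [apply tends_at_initial_plus|apply tends_at_initial_mult].
Qed.

Lemma pd_sumR n (f : nat -> vec -> R) x k (l : nat -> R) :
  (forall j, (j < n)%nat -> pd (f j) x k (l j)) -> pd (fun y => sumR n (fun j => f j y)) x k (sumR n l).
Proof. apply (derivable_pt_lim_sumR n (fun j s => f j (shift x k s))). Qed.

Lemma pd_unique f x k a b : pd f x k a -> pd f x k b -> a = b.
Proof. apply uniqueness_limite. Qed.

(** On the open set Om the flow map is the identity at t = 0, so uniqueness of derivatives fixes its
    gradient there; compactness makes the convergence uniform. *)
Lemma initial_gradient n Om T eta etat etax etaxx :
  is_open_set n Om -> is_bounded_set n Om -> (forall y, Om y -> inRn n y) -> 0 < T ->
  (forall i, (i < n)%nat -> C21 n Om T (eta i) (etat i) (etax i) (etaxx i)) ->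
  (forall x i, Om x -> (i < n)%nat -> eta i x 0 = x i) ->
  forall i j, (i < n)%nat -> (j < n)%nat -> tends_at_initial Om T (etax i j) (krond i j).
Proof.
  intros Ho Hb HR HT HC H0 i j Hi Hj eps Heps.
  destruct (HC i Hi) as (H1 & _ & _ & _ & _ & Hc & _).
  destruct (cont_xt_unif_initial n Om T (etax i j) Hb HT (Hc j Hj) eps Heps) as [tau [Htau H]].
  exists tau. split; [easy|]. intros x t Hx Ht Hle.
  replace (krond i j) with (etax i j x 0); [apply H; auto using closure_incl|].
  apply (pd_unique (fun y => eta i y 0) x j); [apply H1; auto; lra|].
  destruct (open_near n Om x Ho Hx) as [r [Hr Hin]].
  apply (derivable_pt_lim_local_ext (fun s => shift x j s i) _ 0 _ r Hr).
  - intros s Hs. rewrite Rminus_0_r in Hs. symmetry. apply H0; [|easy]. apply Hin.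
    + intros k Hk. unfold shift. destruct (Nat.eqb_spec k j); [lia|now apply HR].
    + intros k _. unfold shift. destruct (Nat.eqb k j).
      * now replace (x k + s - x k) with s by ring.
      * now rewrite Rminus_diag, Rabs_R0.
  - apply is_derive_Reals. unfold shift, krond.
    destruct (Nat.eqb i j); auto_derive; easy || ring.
Qed.

Lemma uniform_ellipticity_time n Om T etax : (1 <= n)%nat -> 0 < T ->
  (forall i j, (i < n)%nat -> (j < n)%nat -> tends_at_initial Om T (etax i j) (krond i j)) ->
  exists tau, 0 < tau < T /\ forall x t, Om x -> 0 <= t <= tau ->
    / 2 <= Jac n etax x t /\
    (forall z, / 4 * pairing n z z
       <= sumR n (fun l => pairing n (fun k => bmat n etax l k x t) z ^ 2)).
Proof.
  intros Hn HT H.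
  assert (HP := subalgebra_tends_at_initial Om T).
  assert (HJ : tends_at_initial Om T (Jac n etax) 1).
  { rewrite <- (detR_krond n). now apply (subalgebra_detR _ n etax krond). }
  assert (Hdev : tends_at_initial Om T (fun x t => sumR n (fun l => sumR n (fun k =>
      (bmat n etax l k x t - krond l k) * (bmat n etax l k x t - krond l k)))) 0).
  { replace 0 with (sumR n (fun l => sumR n (fun k => (krond l k - krond l k) * (krond l k - krond l k))))
      by (apply sumR_eq0; intros; apply sumR_eq0; intros; ring).
    apply (subalgebra_sumR _ n (fun l x t => sumR n (fun k =>
      (bmat n etax l k x t - krond l k) * (bmat n etax l k x t - krond l k)))); [easy|].
    intros l Hl.
    apply (subalgebra_sumR _ n (fun k x t =>
      (bmat n etax l k x t - krond l k) * (bmat n etax l k x t - krond l k))); [easy|].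
    intros k Hk.
    assert (Hb : tends_at_initial Om T (fun x t => bmat n etax l k x t - krond l k) (krond l k - krond l k)).
    { apply (tends_at_initial_plus Om T (bmat n etax l k) (fun _ _ => - krond l k));
        [|apply tends_at_initial_const].
      rewrite <- (cofactor_krond n l k) by easy.
      now apply (subalgebra_cofactor _ n etax krond). }
    now apply tends_at_initial_mult. }
  apply le_INR in Hn. simpl in Hn.
  destruct (HJ (/ 2) ltac:(lra)) as [t1 [Ht1 H1]].
  (* Multiplied by n, this is the bound 1/4 required by [near_identity_elliptic]. *)
  destruct (Hdev (/ (4 * INR n)) ltac:(apply Rinv_0_lt_compat; lra)) as [t2 [Ht2 H2]].
  assert (Hm : 0 < Rmin t1 t2) by now apply Rmin_pos.
  destruct (Rmin_half T (Rmin t1 t2) HT Hm) as [[Ha Hb] Hc].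
  pose proof (Rmin_l t1 t2). pose proof (Rmin_r t1 t2).
  (* Halving keeps tau strictly below T: [C21] gives a time derivative only at interior times. *)
  exists (Rmin T (Rmin t1 t2) / 2). split; [easy|]. intros x t Hx Ht. split.
  - specialize (H1 x t Hx ltac:(lra) ltac:(lra)). apply Rabs_def2 in H1. lra.
  - intros z. apply near_identity_elliptic.
    specialize (H2 x t Hx ltac:(lra) ltac:(lra)). rewrite Rminus_0_r in H2.
    apply Rabs_def2 in H2.
    apply Rle_trans with (INR n * / (4 * INR n)); [|right; field; lra].
    apply Rmult_le_compat_l; lra.
Qed.

(* Carrying out the differentiation in [b_l^k d_k (J^-1 b_l^j d_j e)]; [D l j k]
   stands for [d_k (J^-1 b_l^j)]. *)
Lemma diffusion_expand n (b : nat -> nat -> R) (D : nat -> nat -> nat -> R) (W : nat -> nat -> R)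
  (ex : nat -> R) (exx : nat -> nat -> R) (J : R) : J <> 0 ->
  (forall l k, (l < n)%nat -> (k < n)%nat ->
     W l k = sumR n (fun j => D l j k * ex j + (/ J * b l j) * exx j k)) ->
  J * sumR n (fun l => sumR n (fun k => b l k * W l k)) =
  sumR n (fun l => quad n exx (b l))
  + pairing n (fun j => sumR n (fun l => sumR n (fun k => b l k * (J * D l j k)))) ex.
Proof.
  intros HJ HW. rewrite <- sumR_scal.
  transitivity (sumR n (fun l => quad n exx (b l) +
    sumR n (fun j => sumR n (fun k => b l k * (J * D l j k)) * ex j))).
  - apply sumR_ext. intros l Hl. unfold quad.
    rewrite <- sumR_scal, <- sumR_plus.
    transitivity (sumR n (fun k => sumR n (fun j =>
      b l j * (b l k * exx j k) + ex j * (b l k * (J * D l j k))))).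
    + apply sumR_ext. intros k Hk. rewrite HW by easy. rewrite <- Rmult_assoc, <- sumR_scal.
      apply sumR_ext. intros j _. field. easy.
    + rewrite sumR_swap. apply sumR_ext. intros j _.
      rewrite sumR_plus, !sumR_scal. ring.
  - rewrite sumR_plus. f_equal. unfold pairing. rewrite sumR_swap. apply sumR_ext.
    intros j _. rewrite Rmult_comm, <- sumR_scal. apply sumR_ext. intros; ring.
Qed.

(** Entries of [bmat] with index n or more may be nonzero, whereas a direction must lie in R^n; sums
    over indices below n do not see the change. *)
Definition trunc (n : nat) (b : nat -> R) : vec := fun k => if Nat.ltb k n then b k else 0.

Lemma trunc_inRn n b : inRn n (trunc n b).
Proof. intros k Hk. unfold trunc. destruct (Nat.ltb_spec k n); [lia|easy]. Qed.

Lemma trunc_lt n b k : (k < n)%nat -> trunc n b k = b k.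
Proof. intros Hk. unfold trunc. destruct (Nat.ltb_spec k n); [easy|lia]. Qed.

Lemma pairing_trunc n b z : pairing n (trunc n b) z = pairing n b z.
Proof. apply sumR_ext. intros k Hk. now rewrite trunc_lt. Qed.

Lemma quad_trunc n M b : quad n M (trunc n b) = quad n M b.
Proof.
  apply sumR_ext. intros j Hj. rewrite trunc_lt by easy. f_equal.
  apply sumR_ext. intros k Hk. now rewrite trunc_lt.
Qed.

Lemma bdd_C1_piola_coefficients n Om T tau eta etat etax etaxx :
  is_bounded_set n Om -> (forall y, Om y -> inRn n y) -> tau <= T ->
  (forall i, (i < n)%nat -> C21 n Om T (eta i) (etat i) (etax i) (etaxx i)) ->
  bdd_C1 n Om tau (Jac n etax) /\
  forall l j, (l < n)%nat -> (j < n)%nat -> bdd_C1 n Om tau (bmat n etax l j).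
Proof.
  intros Hb HR Htau HC.
  assert (Hx : forall i j, (i < n)%nat -> (j < n)%nat -> bdd_C1 n Om tau (etax i j)).
  { intros i j Hi Hj. destruct (HC i Hi) as (_ & H2 & _ & _ & _ & Hc1 & Hc2). split.
    - apply (bdd_cont_xt n Om T); auto.
    - exists (fun k => etaxx i j k). intros k Hk. split.
      + apply (bdd_cont_xt n Om T); auto.
      + intros x t HOx Ht. apply H2; auto; lra. }
  assert (HP := subalgebra_bdd_C1 n Om tau). split.
  (* This class ignores its scalar argument; [krond] merely fills the slot. *)
  - now apply (subalgebra_detR (fun f _ => bdd_C1 n Om tau f) n etax krond).
  - intros l j Hl Hj. now apply (subalgebra_cofactor (fun f _ => bdd_C1 n Om tau f) n etax krond).
Qed.

(** Multiplying the energy equation by J / kp normalizes the second order part and gives the weight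
    rho0 J / kp, which stays bounded as rho0 degenerates. The dissipation becomes a nonnegative term
    and is dropped. *)
Lemma energy_supersolution n Om T mu lam kp g1 rho0 v vt vx vxx e et ex exx eta etat etax etaxx tau theta :
  (1 <= n)%nat -> is_open_set n Om -> is_bounded_set n Om -> (forall y, Om y -> inRn n y) ->
  0 < mu -> 0 <= 2 * mu + INR n * lam -> 0 < kp ->
  cont_on n (closure n Om) rho0 -> (forall x, Om x -> 0 < rho0 x) ->
  (forall i, (i < n)%nat -> C21 n Om T (v i) (vt i) (vx i) (vxx i)) ->
  C21 n Om T e et ex exx ->
  (forall i, (i < n)%nat -> C21 n Om T (eta i) (etat i) (etax i) (etaxx i)) ->
  0 < tau < T ->
  (forall x t, Om x -> 0 <= t <= tau ->
    / 2 <= Jac n etax x t /\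
    (forall z, theta * pairing n z z
       <= sumR n (fun l => pairing n (fun k => bmat n etax l k x t) z ^ 2))) ->
  (forall x t, Om x -> 0 < t <= T ->
     exists W : nat -> nat -> R,
       (forall l k, (l < n)%nat -> (k < n)%nat ->
          pd (fun y => / Jac n etax y t *
                 sumR n (fun j => bmat n etax l j y t * ex j y t)) x k (W l k)) /\
       let A := fun i l => sumR n (fun j => bmat n etax l j x t * vx i j x t) in
       let divv := sumR n (fun i => sumR n (fun j => bmat n etax i j x t * vx i j x t)) in
       rho0 x * et x t + g1 * / Jac n etax x t * rho0 x * e x t * divv
       = mu / 2 * / Jac n etax x t *
           sumR n (fun i => sumR n (fun l => (A i l + A l i) ^ 2))
         + lam * / Jac n etax x t * divv ^ 2
         + kp * sumR n (fun l => sumR n (fun k => bmat n etax l k x t * W l k))) ->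
  exists C, 0 < C /\ supersolution n Om tau C theta e et ex exx.
Proof.
  intros Hn Ho Hb HR Hmu Hlam Hkp Hrc Hrpos HCv HCe HCeta Htau Hell Hen.
  destruct (bdd_C1_piola_coefficients n Om T tau eta etat etax etaxx) as [HJ HB]; auto; [lra|].
  assert (HJinv : bdd_C1 n Om tau (fun x t => / Jac n etax x t)).
  { apply (bdd_C1_inv n Om tau _ (/ 2)); [lra| |easy]. intros; now apply Hell. }
  (* The conditions on l and j sit inside the existential so that choice yields a total family; the
     zero function is a placeholder outside. *)
  assert (HD : forall l j, exists D : nat -> vec -> R -> R, (l < n)%nat -> (j < n)%nat ->
    forall k, (k < n)%nat -> bdd Om tau (D k) /\
      forall x t, Om x -> 0 <= t <= tau ->
        pd (fun y => / Jac n etax y t * bmat n etax l j y t) x k (D k x t)).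
  { intros l j. destruct (Nat.lt_ge_cases l n) as [Hl|Hl];
      [destruct (Nat.lt_ge_cases j n) as [Hj|Hj]|].
    - destruct (bdd_C1_mult n Om tau _ _ HJinv (HB l j Hl Hj)) as [_ [D H]]. now exists D.
    - exists (fun _ _ _ => 0). intros; lia.
    - exists (fun _ _ _ => 0). intros; lia. }
  set (D := fun l j => proj1_sig (constructive_indefinite_description _ (HD l j))).
  assert (HDs : forall l j, (l < n)%nat -> (j < n)%nat -> forall k, (k < n)%nat ->
    bdd Om tau (D l j k) /\ forall x t, Om x -> 0 <= t <= tau ->
        pd (fun y => / Jac n etax y t * bmat n etax l j y t) x k (D l j k x t)).
  { intros l j. unfold D. now destruct constructive_indefinite_description. }
  clearbody D. clear HD.
  set (rho := fun x t => rho0 x * Jac n etax x t * / kp).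
  set (divv := fun x t => sumR n (fun i => sumR n (fun j => bmat n etax i j x t * vx i j x t))).
  set (c := fun x t => g1 * (/ Jac n etax x t * divv x t)).
  set (beta := fun j x t => sumR n (fun l => sumR n (fun k =>
                 bmat n etax l k x t * (Jac n etax x t * D l j k x t)))).
  assert (Hbrho : bdd Om tau rho).
  { apply (bdd_mult Om tau (fun x t => rho0 x * Jac n etax x t) (fun _ _ => / kp));
      [|apply bdd_const].
    apply (bdd_mult Om tau (fun x t => rho0 x) (Jac n etax)); [|apply HJ].
    apply (bdd_cont_xt n Om T); auto; [lra|].
    intros x t Hx _ eps Heps. destruct (Hrc x Hx eps Heps) as [d [Hd H]].
    exists d. auto. }
  assert (Hbc : bdd Om tau c).
  { apply bdd_mult; [apply bdd_const|]. apply bdd_mult; [apply HJinv|].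
    apply (bdd_sumR Om tau n (fun i x t => sumR n (fun j => bmat n etax i j x t * vx i j x t))).
    intros i Hi. apply (bdd_sumR Om tau n (fun j x t => bmat n etax i j x t * vx i j x t)).
    intros j Hj. apply bdd_mult; [now apply HB|]. apply (bdd_cont_xt n Om T); auto; [lra|].
    now apply (HCv i Hi). }
  assert (Hbbeta : forall j, (j < n)%nat -> bdd Om tau (beta j)).
  { intros j Hj.
    apply (bdd_sumR Om tau n (fun l x t => sumR n (fun k =>
      bmat n etax l k x t * (Jac n etax x t * D l j k x t)))). intros l Hl.
    apply (bdd_sumR Om tau n (fun k x t => bmat n etax l k x t * (Jac n etax x t * D l j k x t))).
    intros k Hk. apply bdd_mult; [now apply HB|]. apply bdd_mult; [apply HJ|now apply HDs]. }
  assert (HbB : bdd Om tau (fun x t => sumR n (fun l => sumR n (fun k => Rabs (bmat n etax l k x t))))).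
  { apply (bdd_sumR Om tau n (fun l x t => sumR n (fun k => Rabs (bmat n etax l k x t)))).
    intros l Hl. apply (bdd_sumR Om tau n (fun k x t => Rabs (bmat n etax l k x t))).
    intros k Hk. destruct (HB l k Hl Hk) as [[M HM] _]. exists M. intros.
    rewrite Rabs_Rabsolu. auto. }
  destruct Hbrho as [M1 HM1]. destruct Hbc as [M2 HM2]. destruct HbB as [M3 HM3].
  destruct (bdd_uniform Om tau n beta Hbbeta) as [M4 HM4].
  (* One positive constant above all the separate bounds. *)
  exists (1 + Rabs M1 + Rabs M2 + Rabs M3 + Rabs M4).
  assert (HC1 := Rle_abs M1). assert (HC2 := Rle_abs M2). assert (HC3 := Rle_abs M3).
  assert (HC4 := Rle_abs M4).
  pose proof (Rabs_pos M1). pose proof (Rabs_pos M2). pose proof (Rabs_pos M3). pose proof (Rabs_pos M4).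
  split; [lra|].
  intros x t Hx Ht.
  destruct (Hell x t Hx ltac:(lra)) as [HJx Hellx].
  destruct (Hen x t Hx ltac:(lra)) as (W & HW & Heq).
  specialize (HM1 x t Hx ltac:(lra)). specialize (HM2 x t Hx ltac:(lra)).
  specialize (HM3 x t Hx ltac:(lra)).
  exists (rho x t), (c x t), (fun l => trunc n (fun k => bmat n etax l k x t)), (fun j => beta j x t).
  assert (Hrp : 0 < rho x t).
  { unfold rho. specialize (Hrpos x Hx). assert (0 < / kp) by now apply Rinv_0_lt_compat.
    repeat apply Rmult_lt_0_compat; lra. }
  split; [split; [easy|pose proof (Rle_abs (rho x t)); lra]|].
  split; [lra|]. split; [intros; apply trunc_inRn|].
  split; [|split; [|split]].
  - intros l k Hl Hk. rewrite trunc_lt by easy.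
    assert (Rabs (bmat n etax l k x t) <= sumR n (fun l => sumR n (fun k => Rabs (bmat n etax l k x t)))).
    { apply Rle_trans with (sumR n (fun k => Rabs (bmat n etax l k x t))).
      - apply (sumR_term_le n (fun k => Rabs (bmat n etax l k x t))); [|easy]. intros; apply Rabs_pos.
      - apply (sumR_term_le n (fun l => sumR n (fun k => Rabs (bmat n etax l k x t)))); [|easy].
        intros; apply sumR_nonneg; intros; apply Rabs_pos. }
    pose proof (Rle_abs (sumR n (fun l => sumR n (fun k => Rabs (bmat n etax l k x t))))). lra.
  - intros j Hj. specialize (HM4 x t j Hx ltac:(lra) Hj). lra.
  - intros z. rewrite (sumR_ext n _ (fun l => pairing n (fun k => bmat n etax l k x t) z ^ 2));
      [apply Hellx|]. intros l _. now rewrite pairing_trunc.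
  - rewrite (sumR_ext n _ (fun l => quad n (fun j k => exx j k x t) (fun k => bmat n etax l k x t)))
      by (intros; apply quad_trunc).
    unfold beta.
    rewrite <- (diffusion_expand n (fun l k => bmat n etax l k x t) (fun l j k => D l j k x t) W
      (fun j => ex j x t) (fun j k => exx j k x t) (Jac n etax x t)); [|lra|].
    + pose proof (viscous_dissipation_nonneg n mu lam
        (fun i l => sumR n (fun j => bmat n etax l j x t * vx i j x t)) Hn Hmu Hlam) as Hdis.
      cbv zeta beta in Heq, Hdis. fold (divv x t) in Heq, Hdis. unfold rho, c.
      set (J := Jac n etax x t) in *. set (dv := divv x t) in *.
      set (S1 := sumR n (fun i => sumR n (fun l => _))) in Heq, Hdis.
      set (SW := sumR n _) in Heq |- *.
      replace (rho0 x * J * / kp * (et x t + g1 * (/ J * dv) * e x t))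
        with (J * / kp * (rho0 x * et x t + g1 * / J * rho0 x * e x t * dv)) by (field; lra).
      rewrite Heq.
      replace (J * / kp * (mu / 2 * / J * S1 + lam * / J * dv ^ 2 + kp * SW))
        with (/ kp * (mu / 2 * S1 + lam * dv ^ 2) + J * SW) by (field; lra).
      assert (0 < / kp) by now apply Rinv_0_lt_compat.
      assert (0 <= / kp * (mu / 2 * S1 + lam * dv ^ 2)) by (apply Rmult_le_pos; lra). lra.
    (* The equation supplies [W] only as some derivative of the flux; uniqueness identifies it with
       the product rule expression. *)
    + intros l k Hl Hk. apply (pd_unique _ _ _ _ _ (HW l k Hl Hk)).
      replace (fun y => / Jac n etax y t * sumR n (fun j => bmat n etax l j y t * ex j y t))
        with (fun y => sumR n (fun j => (/ Jac n etax y t * bmat n etax l j y t) * ex j y t)).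
      * apply (pd_sumR n (fun j y => (/ Jac n etax y t * bmat n etax l j y t) * ex j y t)).
        intros j Hj.
        apply (pd_mult (fun y => / Jac n etax y t * bmat n etax l j y t) (fun y => ex j y t)).
        -- apply HDs; auto; lra.
        -- destruct HCe as (_ & He2 & _). apply He2; auto; lra.
      * apply functional_extensionality. intros y. rewrite <- sumR_scal. apply sumR_ext.
        intros; ring.
Qed.

Theorem theorem4p2
  (n : nat) (Om : vec -> Prop) (mu lam kappa gam Rg : R)
  (rho0 : vec -> R) (u0 : nat -> vec -> R) (e0 : vec -> R)
  (Hn : (1 <= n)%nat)
  (HOmRn : forall x, Om x -> inRn n x)
  (HOmopen : is_open_set n Om) (HOmbdd : is_bounded_set n Om)
  (HOmsmooth : smooth_boundary n Om)
  (Hmu : 0 < mu) (Hlam : 0 <= 2 * mu + INR n * lam) (Hkappa : 0 < kappa)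
  (Hgam : 1 < gam) (HRg : 0 < Rg)
  (Hrho0c : cont_on n (closure n Om) rho0)
  (Hrho0pos : forall x, Om x -> 0 < rho0 x)
  (Hrho0bd : forall x, boundary n Om x -> rho0 x = 0)
  (Hu0c : forall i, (i < n)%nat -> cont_on n (closure n Om) (u0 i))
  (He0c : cont_on n (closure n Om) e0)
  (He0nonneg : forall x, Om x -> 0 <= e0 x)
  (He0nz : exists x, Om x /\ e0 x <> 0)
  (T : R) (HT : 0 < T) :
  ~ exists (v vt : nat -> vec -> R -> R) (vx : nat -> nat -> vec -> R -> R)
           (vxx : nat -> nat -> nat -> vec -> R -> R)
           (e et : vec -> R -> R) (ex : nat -> vec -> R -> R)
           (exx : nat -> nat -> vec -> R -> R)
           (eta etat : nat -> vec -> R -> R) (etax : nat -> nat -> vec -> R -> R)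
           (etaxx : nat -> nat -> nat -> vec -> R -> R),
    (* regularity: (v, e, eta) in C^{2,1}(closure(Om) x [0,T]) *)
    (forall i, (i < n)%nat -> C21 n Om T (v i) (vt i) (vx i) (vxx i)) /\
    C21 n Om T e et ex exx /\
    (forall i, (i < n)%nat -> C21 n Om T (eta i) (etat i) (etax i) (etaxx i)) /\
    (* eta is a flow map: J > 0, so that J^{-1} makes sense *)
    (forall x t, Om x -> 0 <= t <= T -> 0 < Jac n etax x t) /\
    (* momentum equation *)
    (forall x t i, Om x -> 0 < t <= T -> (i < n)%nat ->
       exists (P : nat -> R) (Q : nat -> nat -> R) (S : nat -> R),
         (forall j, (j < n)%nat ->
            pd (fun y => / Jac n etax y t * rho0 y * e y t) x j (P j)) /\
         (forall l k, (l < n)%nat -> (k < n)%nat ->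
            pd (fun y => / Jac n etax y t *
                   sumR n (fun j => bmat n etax l j y t * vx i j y t)) x k (Q l k)) /\
         (forall k, (k < n)%nat ->
            pd (fun y => / Jac n etax y t *
                   sumR n (fun l => sumR n (fun j => bmat n etax l j y t * vx l j y t)))
               x k (S k)) /\
         rho0 x * vt i x t
         + (gam - 1) * sumR n (fun j => bmat n etax i j x t * P j)
         = mu * sumR n (fun l => sumR n (fun k => bmat n etax l k x t * Q l k))
           + (mu + lam) * sumR n (fun k => bmat n etax i k x t * S k)) /\
    (* energy equation *)
    (forall x t, Om x -> 0 < t <= T ->
       exists W : nat -> nat -> R,
         (forall l k, (l < n)%nat -> (k < n)%nat ->
            pd (fun y => / Jac n etax y t *
                   sumR n (fun j => bmat n etax l j y t * ex j y t)) x k (W l k)) /\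
         let A := fun i l => sumR n (fun j => bmat n etax l j x t * vx i j x t) in
         let divv := sumR n (fun i => sumR n (fun j => bmat n etax i j x t * vx i j x t)) in
         rho0 x * et x t
         + (gam - 1) * / Jac n etax x t * rho0 x * e x t * divv
         = mu / 2 * / Jac n etax x t *
             sumR n (fun i => sumR n (fun l => (A i l + A l i) ^ 2))
           + lam * / Jac n etax x t * divv ^ 2
           + kappa * (gam - 1) / Rg *
             sumR n (fun l => sumR n (fun k => bmat n etax l k x t * W l k))) /\
    (* eta_t = v *)
    (forall x t i, Om x -> 0 < t <= T -> (i < n)%nat -> etat i x t = v i x t) /\
    (* initial data *)
    (forall x i, Om x -> (i < n)%nat ->
       v i x 0 = u0 i x /\ eta i x 0 = x i) /\
    (forall x, Om x -> e x 0 = e0 x) /\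
    (* boundary conditions *)
    (forall x t, boundary n Om x -> 0 < t <= T ->
       e x t = 0 /\ forall j, (j < n)%nat -> ex j x t = 0).
Proof.
  intros (v & vt & vx & vxx & e & et & ex & exx & eta & etat & etax & etaxx &
    HCv & HCe & HCeta & _ & _ & Hen & _ & Hinit & Hinite & Hbd).
  destruct (uniform_ellipticity_time n Om T etax Hn HT) as (tau & Htau & Hell).
  { apply (initial_gradient n Om T eta etat etax etaxx); auto. intros; now apply Hinit. }
  assert (Hkp : 0 < kappa * (gam - 1) / Rg).
  { apply Rdiv_lt_0_compat; [apply Rmult_lt_0_compat; lra|easy]. }
  destruct (energy_supersolution n Om T mu lam (kappa * (gam - 1) / Rg) (gam - 1) rho0
    v vt vx vxx e et ex exx eta etat etax etaxx tau (/ 4)) as (C & HC & Hsup); auto.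
  apply (no_flat_supersolution n Om T tau C (/ 4) e et ex exx); auto; [lra| | |].
  - intros x Hx. rewrite Hinite; auto.
  - destruct He0nz as (x & Hx & Hne). exists x. split; [easy|].
    rewrite Hinite by easy. specialize (He0nonneg x Hx). lra.
  - intros x t Hx Ht. apply Hbd; [easy|lra].
Qed.
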